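(* Let $k$ be a field. If $G$ is a $(C_4,C_5)$-free vertex-decomposable finite simple graph, then $\mathrm{reg}(G)=\mathrm{im}(G)$.
   Context: All graphs are finite, undirected and simple. For a graph $G=(V,E)$ and $u\in V$, $N_G(u)=\{v\in V: uv\in E\}$ and $N_G[u]=N_G(u)\cup\{u\}$; for $U\subseteq V$, $G-U$ is the subgraph induced on $V\setminus U$, and $G-x=G-\{x\}$. $C_n$ denotes the cycle on $n$ vertices, and $G$ is $(C_4,C_5)$-free if no induced subgraph of $G$ is isomorphic to $C_4$ or to $C_5$. A vertex $x$ of $G$ is a shedding vertex if for every independent set $S$ in $G-N_G[x]$ there is $v\in N_G(x)$ such that $S\cup\{v\}$ is independent. $G$ is vertex-decomposable if either its edge set is empty or it has a shedding vertex $x$ such that $G-x$ and $G-N_G[x]$ are both vertex-decomposable. With $V=\{u_1,\dots,u_n\}$, the edge ideal $I(G)\subseteq R=k[x_1,\dots,x_n]$ is generated by the monomials $x_ix_j$ with $u_iu_j\in E$. $\mathrm{reg}(G):=\mathrm{reg}(R/I(G))=\max\{j-i:\beta_{i,j}\neq 0\}$ is the Castelnuovo-Mumford regularity, where $\beta_{i,j}$ are the graded Betti numbers of $R/I(G)$ as an $R$-module (from its minimal graded free resolution). A matching is a set of edges no two of which share an end; a matching $M$ is an induced matching if it occurs as an induced subgraph, i.e. the only edges of $G$ between the endpoints of edges in $M$ are those of $M$. $\mathrm{im}(G)$ is the maximum cardinality of an induced matching of $G$. *)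

(* Defs.v *)
(* mpoly shadows symmetric by its predicate on polynomials, hence ssrbool.symmetric. *)
From HB Require Import structures.
From mathcomp Require Import all_boot all_order all_algebra.
From mathcomp Require Import mpoly.

Set Implicit Arguments.
Unset Strict Implicit.
Unset Printing Implicit Defensive.

Import Order.TTheory GRing.Theory Num.Theory.

Local Open Scope ring_scope.

Record sgraph := SGraph {
  vertex :> finType;
  adj : rel vertex;
  adj_sym : ssrbool.symmetric adj;
  adj_irr : irreflexive adj }.

Definition open_nbhd (G : sgraph) (x : G) : {set G} := [set y | adj x y].
Definition closed_nbhd (G : sgraph) (x : G) : {set G} := x |: open_nbhd x.

Section Induced.
Variables (G : sgraph) (U : {set G}).

Definition induced_adj : rel {x : G | x \in U} :=
  fun x y => adj (val x) (val y).

Lemma induced_adj_sym : ssrbool.symmetric induced_adj.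
Proof. by move=> x y; apply: adj_sym. Qed.

Lemma induced_adj_irr : irreflexive induced_adj.
Proof. by move=> x; apply: adj_irr. Qed.

Definition induced : sgraph := SGraph induced_adj_sym induced_adj_irr.
End Induced.

Definition del (G : sgraph) (U : {set G}) : sgraph := induced (~: U).

Definition graph_iso (G H : sgraph) : Prop :=
  exists2 f : G -> H, bijective f & forall x y, adj (f x) (f y) = adj x y.

Section Cycle.
Variable n : nat.

(* The disequality only matters for n = 1. *)
Definition cycle_adj : rel 'I_n :=
  fun i j => (i != j) && ((j == ordS i) || (i == ordS j)).

Lemma cycle_adj_sym : ssrbool.symmetric cycle_adj.
Proof. by move=> i j; rewrite /cycle_adj eq_sym orbC. Qed.

Lemma cycle_adj_irr : irreflexive cycle_adj.
Proof. by move=> i; rewrite /cycle_adj eqxx. Qed.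

Definition cycle_graph : sgraph := SGraph cycle_adj_sym cycle_adj_irr.
End Cycle.

Definition cycle_free (n : nat) (G : sgraph) : Prop :=
  forall U : {set G}, ~ graph_iso (induced U) (cycle_graph n).

Definition independent (G : sgraph) (S : {set G}) : bool :=
  [forall x in S, forall y in S, ~~ adj x y].

Definition shedding (G : sgraph) (x : G) : Prop :=
  forall S : {set G}, S \subset ~: closed_nbhd x -> independent S ->
    exists2 v, v \in open_nbhd x & independent (v |: S).

Definition edges (G : sgraph) : {set {set G}} :=
  [set [set p.1; p.2] | p in [set p : G * G | adj p.1 p.2]].

Inductive vertex_decomposable (G : sgraph) : Prop :=
| VD_edgeless : edges G = set0 -> vertex_decomposable G
| VD_shed (x : G) : shedding x ->
    vertex_decomposable (del [set x]) ->
    vertex_decomposable (del (closed_nbhd x)) ->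
    vertex_decomposable G.

Definition matching (G : sgraph) (M : {set {set G}}) : bool :=
  (M \subset edges G) && trivIset M.

Definition induced_matching (G : sgraph) (M : {set {set G}}) : bool :=
  matching M && [forall e in edges G, (e \subset cover M) ==> (e \in M)].

Definition im (G : sgraph) : nat :=
  (\max_(M : {set {set G}} | induced_matching M) #|M|)%N.

Definition edge_ideal (k : fieldType) (G : sgraph)
    (p : {mpoly k[#|G|]}) : Prop :=
  exists c : G -> G -> {mpoly k[#|G|]},
    p = \sum_(u : G) \sum_(v : G | adj u v)
          c u v * ('X_(enum_rank u) * 'X_(enum_rank v)).

Section Resolution.
Variables (k : fieldType) (n : nat).
Local Notation S := {mpoly k[n]}.

(* Zero is homogeneous of every degree, and is the only homogeneous polynomial
   of negative degree. *)
Definition homog_of_degree (d : int) (p : S) : Prop :=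
  forall m, m \in msupp p -> (mdeg m)%:Z = d.

(* A graded free resolution  ... -> F_1 -> F_0 -> S/I -> 0  of the S-module S/I,
   for a homogeneous ideal I.  F_i is the module of row vectors
   'rV[S]_(res_rank i), its c-th basis vector having degree res_deg i c, i.e.
   F_i is the direct sum of the S(- res_deg i c).  The map F_(i+1) -> F_i is
   right multiplication by res_diff i.  The map F_0 -> S/I is given by
   homogeneous representatives in S, the entries of res_aug, of the images of
   the basis vectors. *)
Record graded_free_resolution (I : S -> Prop) := GradedFreeResolution {
  res_rank : nat -> nat;
  res_deg : forall i, 'I_(res_rank i) -> int;
  res_aug : 'cV[S]_(res_rank 0);
  res_diff : forall i, 'M[S]_(res_rank i.+1, res_rank i);
  res_aug_homog : forall c, homog_of_degree (res_deg c) (res_aug c 0);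
  res_diff_homog : forall i r c,
    homog_of_degree (res_deg r - res_deg c) (res_diff i r c);
  res_aug_surj : forall p : S,
    exists u : 'rV[S]_(res_rank 0), I (p - (u *m res_aug) 0 0);
  res_exact0 : forall u : 'rV[S]_(res_rank 0),
    I ((u *m res_aug) 0 0) <-> exists w, u = w *m res_diff 0;
  res_exactS : forall i (u : 'rV[S]_(res_rank i.+1)),
    u *m res_diff i = 0 <-> exists w, u = w *m res_diff i.+1 }.

Variable I : S -> Prop.

(* A polynomial lies in the ideal generated by the variables iff its constant
   coefficient is zero. *)
Definition minimal_resolution (F : graded_free_resolution I) : Prop :=
  forall i r c, (res_diff F i r c)@_0%MM = 0.

Definition graded_betti (F : graded_free_resolution I) (i : nat) (j : int)
    : nat :=
  #|[set c : 'I_(res_rank F i) | res_deg c == j]|.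

(* Graded Betti numbers are read off a minimal graded free resolution, so
   "S/I has regularity r" says that such a resolution exists and that each one
   gives r as the maximum of j - i over the nonzero Betti numbers.  In
   particular, there is at most one such r. *)
Definition has_regularity (r : int) : Prop :=
  (exists F : graded_free_resolution I, minimal_resolution F) /\
  (forall F : graded_free_resolution I, minimal_resolution F ->
     (exists (i : nat) (j : int), graded_betti F i j <> 0%N /\ j - i%:Z = r) /\
     (forall (i : nat) (j : int), graded_betti F i j <> 0%N -> j - i%:Z <= r)).

End Resolution.

(* Main.v *)
(* Upper bound.  Let x be a shedding vertex, I = I(G) and I_x = (I : x).  The
   sequence 0 -> S/I_x(-1) -> S/I -> S/(I, x) -> 0 and the horseshoe lemma give
   reg(G) <= max(reg(G - x), reg(G - N[x]) + 1).  As G is (C4, C5)-free, x has a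
   neighbour y with N[y] contained in N[x]; adding xy to an induced matching of
   G - N[x] gives im(G - N[x]) + 1 <= im(G), so reg(G) <= im(G) by induction.

   Lower bound.  For an induced matching M, the ideal J generated by M lies in I,
   which lies in J + (vertices not covered by M).  Both outer ideals are complete
   intersections of monomials with disjoint supports; the top class of the Koszul
   complex of the first survives in that of the second, hence comes from a
   nonzero Betti number of S/I, in homological degree #|M| and degree 2 #|M|.

   Betti numbers of different resolutions are compared through the constant terms
   of lifted chain maps.  A minimal resolution exists because a finite resolution
   can be reduced by cancelling the unit entries of its matrices. *)
Require Import Defs.
From HB Require Import structures.
From mathcomp Require Import all_boot all_order all_algebra.
From mathcomp Require Import mpoly.
From Stdlib Require Import ClassicalEpsilon.

Set Implicit Arguments.
Unset Strict Implicit.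
Unset Printing Implicit Defensive.

Import Order.TTheory GRing.Theory Num.Theory.

Local Open Scope ring_scope.

(** The horseshoe needs both of its inputs over one polynomial ring, so the graphs [G - x] and [G -
    N[x]] must not get rings of their own. The induction therefore runs over ideals of the ring of
    [G] generated by the edges inside a set [U] and the variables in a set [W]: adding [x] to the
    ideal moves [x] from [U] to [W], and the colon by [x] removes [N[x]] from [U] and puts the
    neighbours of [x] into [W]. Extra variables do not raise the regularity, so the bound depends on
    the remaining graph alone.

    The horseshoe resolution need not be minimal, while regularity is read off minimal ones. Hence
    the induction carries only a bound on the basis degrees of some resolution of finite length. The
    comparison lemma [betti_between], with the identity as [alpha], moves this bound to every
    minimal resolution; with an inclusion of Koszul complexes as [alpha], the same lemma gives the
    lower bound. Tor never has to be constructed. *)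

Lemma dependent_choice (X : nat -> Type) (P : forall i, X i -> Prop)
    (R : forall i, X i -> X i.+1 -> Prop) (x0 : X 0) :
    P 0 x0 ->
    (forall i x, P i x -> exists2 y, P i.+1 y & R i x y) ->
  exists2 s : forall i, X i, s 0 = x0 & forall i, R i (s i) (s i.+1).
Proof.
move=> Px0 step.
have next i (x : {x | P i x}) : {y : {y | P i.+1 y} | R i (sval x) (sval y)}.
  apply: constructive_indefinite_description.
  by case: x => x Px; have [y Py Rxy] := step i x Px; exists (exist _ y Py).
pose s := fix s i : {x | P i x} :=
  if i is j.+1 then sval (next j (s j)) else exist _ x0 Px0.
by exists (fun i => sval (s i)) => // i /=; case: (next i (s i)).
Qed.

(** * Graded pieces, homogeneous matrices and graded ideals *)

Section Homogeneous.
Variables (k : fieldType) (n : nat).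
Local Notation S := {mpoly k[n]}.
Implicit Types (p q : S) (d e : int).

(** Degrees are integers so that [hcomp (d - e)] makes sense for every shift; in negative degree the
    component is 0. *)
Definition hcomp d p : S :=
  \sum_(m <- msupp p | (mdeg m)%:Z == d) p@_m *: 'X_[m].

Lemma mcoeff_hcomp d p m :
  (hcomp d p)@_m = if (mdeg m)%:Z == d then p@_m else 0.
Proof.
rewrite /hcomp raddf_sum /=.
under eq_bigr do rewrite mcoeffZ mcoeffX.
have [pm|pm] := boolP (m \in msupp p); last first.
  rewrite memN_msupp_eq0 // if_same big1_seq // => m' /andP[_ m'p].
  by rewrite (negPf (memPn pm _ m'p)) mulr0.
rewrite big_mkcond (bigD1_seq m) ?msupp_uniq //= eqxx mulr1 big1_seq ?addr0 //.
by move=> m' /andP[/negPf-> _]; rewrite mulr0 if_same.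
Qed.

Lemma hcomp_homogE d p : homog_of_degree d p <-> hcomp d p = p.
Proof.
split=> [hp | <- m].
  apply/mpolyP => m; rewrite mcoeff_hcomp; case: eqP => // md.
  by apply/esym/memN_msupp_eq0/negP => /hp.
by rewrite mcoeff_msupp mcoeff_hcomp; case: ifP => [/eqP|]; rewrite ?eqxx.
Qed.

Lemma homog_coeff d p m :
  homog_of_degree d p -> p@_m != 0 -> (mdeg m)%:Z = d.
Proof. by move=> hp; rewrite -mcoeff_msupp => /hp. Qed.

Lemma homog_hcomp d p : homog_of_degree d (hcomp d p).
Proof.
by move=> m; rewrite mcoeff_msupp mcoeff_hcomp; case: ifP => [/eqP|]; rewrite ?eqxx.
Qed.

(** This turns a nonzero constant term in an entry of a homogeneous matrix, whose degree is
    [da r - db c], into an equality of basis degrees. *)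
Lemma homog_const d p : homog_of_degree d p -> p@_0%MM != 0 -> d = 0.
Proof. by move=> hp /(homog_coeff hp); rewrite mdeg0. Qed.

Lemma homog0 d : homog_of_degree d (0 : S).
Proof. by move=> m; rewrite msupp0. Qed.

Lemma hcomp_is_additive d : additive (hcomp d).
Proof.
move=> p q; apply/mpolyP => m; rewrite mcoeffB !mcoeff_hcomp mcoeffB.
by case: eqP; rewrite ?subr0.
Qed.
HB.instance Definition _ d := GRing.isAdditive.Build S S (hcomp d)
  (hcomp_is_additive d).

Lemma hcompM d e p q :
  homog_of_degree e q -> hcomp d (p * q) = hcomp (d - e) p * q.
Proof.
move=> hq; apply/mpolyP => m; rewrite mcoeff_hcomp !mcoeffM.
have [md|md] := eqVneq (mdeg m)%:Z d.
  apply: eq_bigr => -[m1 m2] /=.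
  move: (bmnm m1) (bmnm m2) => {m1 m2} m1 m2 /eqP /(congr1 (@mdeg n)).
  rewrite mdegD mcoeff_hcomp => mE; have [->|q2] := eqVneq (q@_m2) 0;
    first by rewrite !mulr0.
  suff -> : (mdeg m1)%:Z = d - e by rewrite eqxx.
  by move: md; rewrite mE -(homog_coeff hq q2) PoszD => <-; rewrite addrK.
apply/esym; apply: big1 => -[m1 m2] /=.
  move: (bmnm m1) (bmnm m2) => {m1 m2} m1 m2 /eqP /(congr1 (@mdeg n)).
rewrite mdegD mcoeff_hcomp => mE; have [->|q2] := eqVneq (q@_m2) 0;
  first by rewrite mulr0.
case: eqP => [m1d|]; last by rewrite mul0r.
by move/eqP: md; case; rewrite mE PoszD m1d (homog_coeff hq q2) subrK.
Qed.

Lemma homogD d p q :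
  homog_of_degree d p -> homog_of_degree d q -> homog_of_degree d (p + q).
Proof. by rewrite !hcomp_homogE raddfD /= => -> ->. Qed.

Lemma homogN d p : homog_of_degree d p -> homog_of_degree d (- p).
Proof. by rewrite !hcomp_homogE raddfN /= => ->. Qed.

Lemma homogM d e p q :
  homog_of_degree d p -> homog_of_degree e q -> homog_of_degree (d + e) (p * q).
Proof.
move=> hp hq; apply/hcomp_homogE; rewrite (hcompM _ _ hq) addrK.
by move/hcomp_homogE: hp => ->.
Qed.

Lemma homog_sum d (I : Type) (r : seq I) (P : pred I) (F : I -> S) :
  (forall i, P i -> homog_of_degree d (F i)) ->
  homog_of_degree d (\sum_(i <- r | P i) F i).
Proof.
by move=> hF; elim/big_ind: _ => // [|p q]; [apply: homog0 | apply: homogD].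
Qed.

Lemma homogX m : homog_of_degree (mdeg m)%:Z ('X_[m] : S).
Proof. by move=> m'; rewrite msuppX inE => /eqP->. Qed.

Lemma homogC (c : k) : homog_of_degree 0 (c%:MP : S).
Proof. by move=> m; rewrite msuppC; case: eqP; rewrite ?inE // => _ /eqP->;
  rewrite mdeg0. Qed.

Lemma mcoeff0M p q : (p * q)@_0%MM = p@_0%MM * q@_0%MM.
Proof. exact: (rmorphM (mcoeff 0%MM)). Qed.

Lemma homog_deg0 p : homog_of_degree 0 p -> p = (p@_0%MM)%:MP.
Proof.
move=> hp; apply/mpolyP => m; rewrite mcoeffC; case: eqP => [->|m0].
  by rewrite mulr1.
rewrite mulr0; apply/eqP/negPn/negP => /(homog_coeff hp) /eqP.
by rewrite eqz_nat mdeg_eq0 => /eqP.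
Qed.

Definition homog_mx a b (da : 'I_a -> int) (db : 'I_b -> int) (M : 'M[S]_(a, b)) :=
  forall r c, homog_of_degree (da r - db c) (M r c).

(** The matrices that vanish modulo the ideal of the variables; constant terms are what is left of a
    matrix after tensoring with [k]. *)
Definition radical_mx a b (M : 'M[S]_(a, b)) := forall r c, (M r c)@_0%MM = 0.

Lemma homog_mxM a b c (da : 'I_a -> int) (db : 'I_b -> int) (dc : 'I_c -> int) M N :
  homog_mx da db M -> homog_mx db dc N -> homog_mx da dc (M *m N).
Proof.
move=> hM hN r s; rewrite mxE; apply: homog_sum => t _.
by rewrite -[_ - _](subrKA (db t)); apply: homogM.
Qed.

Lemma radical_mulmxr a b c (M : 'M[S]_(a, b)) (N : 'M_(b, c)) :
  radical_mx N -> radical_mx (M *m N).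
Proof.
by move=> hN r s; rewrite mxE raddf_sum big1 //= => t _; rewrite mcoeff0M hN mulr0.
Qed.

Lemma radical_mulmxl a b c (M : 'M[S]_(a, b)) (N : 'M_(b, c)) :
  radical_mx M -> radical_mx (M *m N).
Proof.
by move=> hM r s; rewrite mxE raddf_sum big1 //= => t _; rewrite mcoeff0M hM mul0r.
Qed.

Lemma factor_rows a b c (M : 'M[S]_(a, b)) (N : 'M_(c, b)) :
  (forall r, exists w, row r M = w *m N) -> exists W, M = W *m N.
Proof.
move=> /fin_all_exists[w wE]; exists (\matrix_r w r).
by apply/row_matrixP => r; rewrite row_mul rowK.
Qed.

(** Taking the component of degree [da r - db s] in each entry of [M = W *m N] leaves [M] as it is
    and, [N] being homogeneous, replaces each entry of [W] by one component. *)
Lemma factor_homog a b c (da : 'I_a -> int) (db : 'I_b -> int) (dc : 'I_c -> int)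
    (M : 'M[S]_(a, b)) (N : 'M_(c, b)) :
  homog_mx da db M -> homog_mx dc db N ->
  (forall r, exists w, row r M = w *m N) ->
  exists2 W, homog_mx da dc W & M = W *m N.
Proof.
move=> hM hN /factor_rows[W MW]; subst M.
exists (\matrix_(r, s) hcomp (da r - dc s) (W r s)).
  by move=> r s; rewrite mxE; apply: homog_hcomp.
apply/matrixP => r s; have /hcomp_homogE <- := hM r s; rewrite !mxE raddf_sum /=.
apply: eq_bigr => t _; rewrite mxE (hcompM _ _ (hN t s)).
by rewrite opprB subrKA.
Qed.

Record graded_ideal (I : S -> Prop) : Prop := GradedIdeal {
  ideal0 : I 0;
  idealD : forall p q, I p -> I q -> I (p + q);
  idealMl : forall p q, I q -> I (p * q);
  ideal_hcomp : forall d p, I p -> I (hcomp d p) }.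

Section Ideal.
Variables (I : S -> Prop) (gI : graded_ideal I).

Lemma idealN p : I p -> I (- p).
Proof. by rewrite -mulN1r; apply: idealMl. Qed.

Lemma idealB p q : I p -> I q -> I (p - q).
Proof. by move=> Ip Iq; apply: idealD => //; apply: idealN. Qed.

Definition ideal_col a (v : 'cV[S]_a) := forall r, I (v r 0).

Lemma ideal_colD a (v w : 'cV_a) :
  ideal_col v -> ideal_col w -> ideal_col (v + w).
Proof. by move=> Iv Iw r; rewrite mxE; apply: idealD. Qed.

Lemma ideal_colB a (v w : 'cV_a) :
  ideal_col v -> ideal_col w -> ideal_col (v - w).
Proof. by move=> Iv Iw r; rewrite !mxE; apply: idealB. Qed.

Lemma ideal_col_sym a (v w : 'cV_a) : ideal_col (v - w) -> ideal_col (w - v).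
Proof. by move=> Ivw r; rewrite -opprB mxE; apply: idealN. Qed.

Lemma ideal_col_trans a (v u w : 'cV_a) :
  ideal_col (v - u) -> ideal_col (u - w) -> ideal_col (v - w).
Proof. by move=> Ivu Iuw; rewrite -[v](subrK u) -addrA; apply: ideal_colD. Qed.

Lemma ideal_col_congr a (v w : 'cV_a) :
  ideal_col (v - w) -> ideal_col w -> ideal_col v.
Proof. by move=> Ivw Iw; rewrite -[v](subrK w); apply: ideal_colD. Qed.

Lemma ideal_colM a b (M : 'M_(a, b)) (v : 'cV_b) :
  ideal_col v -> ideal_col (M *m v).
Proof.
move=> Iv r; rewrite mxE; elim/big_ind: _ => // [|p q|t _].
- exact: ideal0.
- exact: idealD.
- exact: idealMl.
Qed.

(** The argument of [factor_homog] with congruence modulo [I] in place of equality. It starts chain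
    maps at the augmentations. *)
Lemma lift_mod_ideal a b (da : 'I_a -> int) (db : 'I_b -> int)
    (v : 'cV_a) (eps : 'cV_b) :
  (forall r, homog_of_degree (da r) (v r 0)) ->
  (forall c, homog_of_degree (db c) (eps c 0)) ->
  (forall p, exists u : 'rV_b, I (p - (u *m eps) 0 0)) ->
  exists2 W : 'M_(a, b), homog_mx da db W & ideal_col (v - W *m eps).
Proof.
move=> hv he surj.
have /fin_all_exists[w Iw] r := surj (v r 0).
exists (\matrix_(r, c) hcomp (da r - db c) (w r 0 c)).
  by move=> r c; rewrite mxE; apply: homog_hcomp.
move=> r; have := ideal_hcomp gI (da r) (Iw r).
rewrite raddfB /=; have /hcomp_homogE -> := hv r.
congr I; rewrite !mxE; congr (_ - _); rewrite raddf_sum; apply: eq_bigr => c _ /=.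
by rewrite mxE (hcompM _ _ (he c)).
Qed.

End Ideal.
End Homogeneous.

(** * Comparison of resolutions *)

Section Resolutions.
Variables (k : fieldType) (n : nat).
Local Notation S := {mpoly k[n]}.
Local Notation dg F i := (@res_deg _ _ _ F i).

Section Exactness.
Variables (I : S -> Prop) (F : graded_free_resolution I).

Lemma res_aug_row0 a (M : 'M_(a, res_rank F 0)) :
    ideal_col I (M *m res_aug F) ->
  forall r, exists w, row r M = w *m res_diff F 0.
Proof. by move=> IM r; apply/res_exact0; rewrite -row_mul mxE. Qed.

Lemma res_diff_rowS i a (M : 'M_(a, res_rank F i.+1)) :
    M *m res_diff F i = 0 ->
  forall r, exists w, row r M = w *m res_diff F i.+1.
Proof. by move=> M0 r; apply/res_exactS; rewrite -row_mul M0 row0. Qed.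

Lemma res_aug_diff : ideal_col I (res_diff F 0 *m res_aug F).
Proof.
move=> r; have /(@res_exact0 _ _ _ F) : exists w, row r (res_diff F 0) = w *m
  res_diff F 0.
  by exists (delta_mx 0 r); rewrite rowE.
by rewrite -row_mul mxE.
Qed.

Lemma res_diff_diff i : res_diff F i.+1 *m res_diff F i = 0.
Proof.
apply/row_matrixP => r; rewrite row0 row_mul; apply/res_exactS.
by exists (delta_mx 0 r); rewrite rowE.
Qed.

Lemma res_diff_homog_mx i :
  homog_mx (dg F i.+1) (dg F i) (res_diff F i).
Proof. exact: res_diff_homog. Qed.

End Exactness.
Arguments res_aug_diff {I} F r.
Arguments res_diff_homog_mx {I} F i r c.


(* Chain maps f : A -> B and g : B -> C lifting the surjections
   S/I_A -> S/I_B -> S/I_C compose to a map homotopic to alpha.  Since A and C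
   are minimal, g f and alpha have the same constant terms. *)
Lemma betti_between (I_A I_B I_C : S -> Prop) (A : graded_free_resolution I_A)
    (B : graded_free_resolution I_B) (C : graded_free_resolution I_C)
    (alpha : forall i, 'M_(res_rank A i, res_rank C i)) :
    graded_ideal I_B -> graded_ideal I_C ->
    (forall p, I_A p -> I_B p) -> (forall p, I_B p -> I_C p) ->
    minimal_resolution A -> minimal_resolution C ->
    ideal_col I_C (alpha 0%N *m res_aug C - res_aug A) ->
    (forall i, res_diff A i *m alpha i = alpha i.+1 *m res_diff C i) ->
  forall i r c, (alpha i r c)@_0%MM != 0 ->
  exists b, dg B i b = dg A i r.
Proof.
move=> gB gC AB BC minA minC alpha0 alphaS.
(* The invariant at [i] speaks of maps in degree [i] only, so plain induction suffices. [X] stands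
   for the other homotopy term, the differential of [A] times the previous [H] (0 at the start);
   minimality of [A] makes it radical. *)
have lifts i : exists (f : 'M_(res_rank A i, res_rank B i))
    (g : 'M_(res_rank B i, res_rank C i)) (X : 'M_(res_rank A i, res_rank C i)),
  [/\ homog_mx (dg A i) (dg B i) f
          /\ homog_mx (dg B i) (dg C i) g,
    (forall r, exists w, row r (res_diff A i *m f) = w *m res_diff B i)
      /\ (forall r, exists w, row r (res_diff B i *m g) = w *m res_diff C i),
    radical_mx X, res_diff A i *m X = 0 &
    exists H, f *m g - alpha i - X = H *m res_diff C i].
  elim: i => [|i [f [g [X [[hf hg] [lf lg] radX dX [H HE]]]]]].
    have [f hf If] := lift_mod_ideal gB (@res_aug_homog _ _ _ A)
      (@res_aug_homog _ _ _ B) (@res_aug_surj _ _ _ B).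
    have [g hg Ig] := lift_mod_ideal gC (@res_aug_homog _ _ _ B)
      (@res_aug_homog _ _ _ C) (@res_aug_surj _ _ _ C).
    exists f, g, 0; split=> //.
    - split; apply: res_aug_row0; rewrite -mulmxA.
        apply: (ideal_col_congr gB (w := res_diff A 0 *m res_aug A)).
          by rewrite -mulmxBr; apply/(ideal_colM gB)/(ideal_col_sym gB).
        by move=> r; apply: AB; apply: res_aug_diff.
      apply: (ideal_col_congr gC (w := res_diff B 0 *m res_aug B)).
        by rewrite -mulmxBr; apply/(ideal_colM gC)/(ideal_col_sym gC).
      by move=> r; apply: BC; apply: res_aug_diff.
    - by move=> r c; rewrite mxE mcoeff0.
    - by rewrite mulmx0.
    apply: factor_rows; apply: res_aug_row0.
    rewrite subr0 mulmxBl -mulmxA.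
    apply: (ideal_col_trans gC (u := f *m res_aug B)).
      by rewrite -mulmxBr; apply/(ideal_colM gC)/(ideal_col_sym gC).
    apply: (ideal_col_trans gC (u := res_aug A)).
      by apply: (ideal_col_sym gC) => r; apply/BC/If.
    exact: (ideal_col_sym gC).
  have [f' hf' fE] :=
    factor_homog (homog_mxM (res_diff_homog_mx A i) hf) (res_diff_homog_mx B i) lf.
  have [g' hg' gE] :=
    factor_homog (homog_mxM (res_diff_homog_mx B i) hg) (res_diff_homog_mx C i) lg.
  exists f', g', (res_diff A i *m H); split=> //.
  - split; apply: res_diff_rowS; rewrite -mulmxA.
      by rewrite -fE mulmxA res_diff_diff mul0mx.
    by rewrite -gE mulmxA res_diff_diff mul0mx.
  - exact: radical_mulmxl.
  - by rewrite mulmxA res_diff_diff mul0mx.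
  apply: factor_rows; apply: res_diff_rowS.
  rewrite !mulmxBl -!mulmxA -gE -HE -alphaS !mulmxBr dX subr0 !mulmxA fE.
  by rewrite subrr.
move=> i r c; have [f [g [X [[hf hg] _ radX _ [H HE]]]]] := lifts i.
have -> : alpha i = f *m g - X - H *m res_diff C i.
  by rewrite -HE [_ - alpha i - X]addrAC subKr.
rewrite !mxE !mcoeffB radX subr0 raddf_sum /= [X in _ - X]raddf_sum /=.
rewrite [X in _ - X]big1 ?subr0 => [fg0|t _]; last by rewrite mcoeff0M minC mulr0.
have [b fb] : exists b, (f r b)@_0%MM != 0.
  apply/existsP; apply: contraNT fg0 => /existsPn f0.
  by rewrite big1 // => t _; rewrite mcoeff0M (eqP (negPn (f0 t))) mul0r.
by exists b; apply/esym/eqP; rewrite -subr_eq0 (homog_const (hf r b) fb).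
Qed.
End Resolutions.
Arguments res_aug_diff {k n I} F r.
Arguments res_diff_homog_mx {k n I} F i r c.

(** * Block matrices between direct sums of graded free modules *)

Section Blocks.
Variables (k : fieldType) (n : nat).
Local Notation S := {mpoly k[n]}.

Definition exact_mx a b c (M : 'M[S]_(a, b)) (N : 'M[S]_(b, c)) :=
  forall u : 'rV_b, u *m N = 0 <-> exists w, u = w *m M.

Lemma exact_mx_mul0 a b c (M : 'M[S]_(a, b)) (N : 'M[S]_(b, c)) :
  exact_mx M N -> M *m N = 0.
Proof.
move=> MN; apply/row_matrixP => r; rewrite row0 row_mul; apply/MN.
by exists (delta_mx 0 r); rewrite rowE.
Qed.

(** One diagram chase for the mapping cone and the horseshoe alike: the first block of a cycle lifts
    to [w1], and subtracting [w1 *m P] from the second block leaves a cycle for [N2]. *)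
Lemma exact_block_mx a1 b1 c1 a2 b2 c2
    (M1 : 'M[S]_(a1, b1)) (N1 : 'M[S]_(b1, c1))
    (M2 : 'M[S]_(a2, b2)) (N2 : 'M[S]_(b2, c2))
    (P : 'M[S]_(a1, b2)) (Q : 'M[S]_(b1, c2)) :
  exact_mx M1 N1 -> exact_mx M2 N2 -> M1 *m Q + P *m N2 = 0 ->
  exact_mx (block_mx M1 P 0 M2) (block_mx N1 Q 0 N2).
Proof.
move=> MN1 MN2 MQ u; split=> [|[w ->]]; last first.
  rewrite -mulmxA mulmx_block !(mul0mx, mulmx0) !(addr0, add0r) MQ.
  by rewrite (exact_mx_mul0 MN1) (exact_mx_mul0 MN2) block_mx0 mulmx0.
rewrite -[u]hsubmxK; set u1 := lsubmx u; set u2 := rsubmx u.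
rewrite mul_row_block mulmx0 addr0 -row_mx0 => /eq_row_mx[/MN1[w1 u1E]].
have -> : u1 *m Q = - (w1 *m P) *m N2.
  apply/eqP; rewrite -subr_eq0 mulNmx opprK u1E -!mulmxA -mulmxDr MQ.
  by rewrite mulmx0.
rewrite addrC -mulmxDl => /MN2[w2 u2E]; exists (row_mx w1 w2).
by rewrite mul_row_block mulmx0 addr0 -u1E -u2E addrC subrK.
Qed.

Definition dsum a b (da : 'I_a -> int) (db : 'I_b -> int) (c : 'I_(a + b)) :=
  match split c with inl c => da c | inr c => db c end.

Lemma dsum_lshift a b da db c : @dsum a b da db (lshift b c) = da c.
Proof. by rewrite /dsum (unsplitK (inl c)). Qed.

Lemma dsum_rshift a b da db c : @dsum a b da db (rshift a c) = db c.
Proof. by rewrite /dsum (unsplitK (inr c)). Qed.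

(** [P] depends on index and degree together, so that [elim/dsumP] replaces a basis vector and its
    degree at once. *)
Lemma dsumP a b (P : 'I_(a + b) -> int -> Prop) da db :
  (forall c, P (lshift b c) (da c)) -> (forall c, P (rshift a c) (db c)) ->
  forall c, P c (dsum da db c).
Proof.
move=> Pa Pb c; rewrite -(splitK c); case: (split c) => j /=.
  by rewrite dsum_lshift.
by rewrite dsum_rshift.
Qed.

Lemma homog_col_mx a1 a2 b (d1 : 'I_a1 -> int) (d2 : 'I_a2 -> int)
    (db : 'I_b -> int) (M : 'M[S]_(a1, b)) (N : 'M[S]_(a2, b)) :
  homog_mx d1 db M -> homog_mx d2 db N ->
  homog_mx (dsum d1 d2) db (col_mx M N).
Proof.
move=> hM hN r c; elim/dsumP: r / (dsum d1 d2 r) => r.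
  by rewrite col_mxEu.
by rewrite col_mxEd.
Qed.

Lemma homog_row_mx a b1 b2 (da : 'I_a -> int) (d1 : 'I_b1 -> int)
    (d2 : 'I_b2 -> int) (M : 'M[S]_(a, b1)) (N : 'M[S]_(a, b2)) :
  homog_mx da d1 M -> homog_mx da d2 N ->
  homog_mx da (dsum d1 d2) (row_mx M N).
Proof.
move=> hM hN r c; elim/dsumP: c / (dsum d1 d2 c) => c.
  by rewrite row_mxEl.
by rewrite row_mxEr.
Qed.

Lemma homog_mx0 a b (da : 'I_a -> int) (db : 'I_b -> int) :
  homog_mx da db (0 : 'M[S]_(a, b)).
Proof. by move=> r c; rewrite mxE; apply: homog0. Qed.

Lemma homog_mxN a b (da : 'I_a -> int) (db : 'I_b -> int) (M : 'M[S]_(a, b)) :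
  homog_mx da db M -> homog_mx da db (- M).
Proof. by move=> hM r c; rewrite mxE; apply: homogN. Qed.

Lemma homog_block_mx a1 a2 b1 b2 (da1 : 'I_a1 -> int) (da2 : 'I_a2 -> int)
    (db1 : 'I_b1 -> int) (db2 : 'I_b2 -> int)
    (M : 'M[S]_(a1, b1)) (N : 'M[S]_(a1, b2)) (P : 'M[S]_(a2, b1)) Q :
  homog_mx da1 db1 M -> homog_mx da1 db2 N ->
  homog_mx da2 db1 P -> homog_mx da2 db2 Q ->
  homog_mx (dsum da1 da2) (dsum db1 db2) (block_mx M N P Q).
Proof. by move=> *; apply: homog_col_mx; apply: homog_row_mx. Qed.

Lemma homog_scalar_mx a (da : 'I_a -> int) e (f : S) :
  homog_of_degree e f -> homog_mx (fun c => da c + e) da f%:M.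
Proof.
move=> hf r c; rewrite mxE; case: eqP => [->|_].
  by rewrite addrAC subrr add0r.
exact: homog0.
Qed.

Lemma homog_mx_shift a b (da : 'I_a -> int) (db : 'I_b -> int) e (M : 'M[S]_(a,
  b)) :
  homog_mx da db M -> homog_mx (fun c => da c + e) (fun c => db c + e) M.
Proof. by move=> hM r c; rewrite opprD addrACA subrr addr0. Qed.

Lemma radical_col_mx a1 a2 b (M : 'M[S]_(a1, b)) (N : 'M[S]_(a2, b)) :
  radical_mx M -> radical_mx N -> radical_mx (col_mx M N).
Proof. by move=> hM hN r c; rewrite mxE; case: split. Qed.

Lemma radical_row_mx a b1 b2 (M : 'M[S]_(a, b1)) (N : 'M[S]_(a, b2)) :
  radical_mx M -> radical_mx N -> radical_mx (row_mx M N).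
Proof. by move=> hM hN r c; rewrite mxE; case: split. Qed.

Lemma radical_mx0 a b : radical_mx (0 : 'M[S]_(a, b)).
Proof. by move=> r c; rewrite mxE mcoeff0. Qed.

Lemma radical_mxN a b (M : 'M[S]_(a, b)) : radical_mx M -> radical_mx (- M).
Proof. by move=> hM r c; rewrite mxE mcoeffN hM oppr0. Qed.

Lemma radical_scalar_mx a (f : S) : f@_0%MM = 0 -> radical_mx (f%:M : 'M[S]_a).
Proof. by move=> f0 r c; rewrite mxE raddfMn /= f0 mul0rn. Qed.

End Blocks.

(** * The mapping cone of a regular element *)

Section Cone.
Variables (k : fieldType) (n : nat).
Local Notation S := {mpoly k[n]}.
Local Notation dg F i := (@res_deg _ _ _ F i).
Variables (I : S -> Prop) (F : graded_free_resolution I).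
Variables (f : S) (e : int).
Hypotheses (gI : graded_ideal I) (hf : homog_of_degree e f).
Hypothesis f_regular : forall p, I (f * p) -> I p.

Definition ideal_add (p : S) : Prop := exists q, I (p - f * q).

Definition cone_rank i :=
  if i is j.+1 then (res_rank F j + res_rank F j.+1)%N else res_rank F 0.

Definition cone_deg i : 'I_(cone_rank i) -> int :=
  match i with
  | 0 => dg F 0
  | j.+1 => dsum (fun c => dg F j c + e) (dg F j.+1)
  end.

(** Mapping cone of multiplication by [f] on [F]: a shifted copy of [F], absent in homological
    degree 0, plus [F] itself. The sign on the shifted copy makes the two [f] terms of the square
    cancel. *)
Definition cone_diff i : 'M[S]_(cone_rank i.+1, cone_rank i) :=
  match i with
  | 0 => col_mx f%:M (res_diff F 0)
  | j.+1 => block_mx (- res_diff F j) f%:M 0 (res_diff F j.+1)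
  end.

Lemma cone_diff_homog i : homog_mx (@cone_deg i.+1) (@cone_deg i) (cone_diff i).
Proof.
case: i => [|i] /=.
  by apply: homog_col_mx; [apply: homog_scalar_mx | apply: res_diff_homog_mx].
apply: homog_block_mx.
- by apply/homog_mxN/homog_mx_shift/res_diff_homog_mx.
- exact: homog_scalar_mx.
- exact: homog_mx0.
- exact: res_diff_homog_mx.
Qed.

Lemma cone_aug_surj (p : S) :
  exists u : 'rV_(cone_rank 0), ideal_add (p - (u *m res_aug F) 0 0).
Proof.
by have [u Iu] := res_aug_surj F p; exists u, 0; rewrite mulr0 subr0.
Qed.

Lemma cone_exact0 (u : 'rV[S]_(cone_rank 0)) :
  ideal_add ((u *m res_aug F) 0 0) <-> exists w, u = w *m cone_diff 0.
Proof.
split=> [[q Iq]|[w ->]].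
  have [t It] := res_aug_surj F q.
  have /res_exact0[w uE] : I (((u - f *: t) *m res_aug F) 0 0).
    rewrite mulmxBl -scalemxAl !mxE.
    have -> : forall a b : S, a - f * b = (a - f * q) + f * (q - b).
      by move=> a b; rewrite mulrBr addrA subrK.
    rewrite !mxE in Iq It.
    by apply: (idealD gI) => //; apply: (idealMl gI).
  by exists (row_mx t w); rewrite mul_row_col mul_mx_scalar -uE addrC subrK.
rewrite -[w]hsubmxK mul_row_col mul_mx_scalar mulmxDl -scalemxAl 2!mxE.
exists ((lsubmx w *m res_aug F) 0 0); rewrite addrAC subrr add0r.
by rewrite -mulmxA; apply: (ideal_colM gI); apply: res_aug_diff.
Qed.

(** Higher up this is [exact_block_mx]. At the bottom the first block [u1] satisfies no cycle
    condition of its own; instead [f *: u1] is a boundary up to sign, so [f] times its augmentation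
    lies in [I], and regularity of [f] removes the factor. *)
Lemma cone_exactS i : exact_mx (cone_diff i.+1) (cone_diff i).
Proof.
case: i => [|i] /=; last first.
  apply: exact_block_mx.
  - move=> u; rewrite mulmxN; split=> [/eqP|[w ->]].
      rewrite oppr_eq0 => /eqP /res_exactS[w ->]; exists (- w).
      by rewrite mulmxN mulNmx opprK.
    by rewrite mulmxN mulNmx opprK -mulmxA res_diff_diff mulmx0.
  - exact: res_exactS.
  - by rewrite mul_mx_scalar mul_scalar_mx scalerN addNr.
move=> u; rewrite -[u]hsubmxK; set u1 := lsubmx u; set u2 := rsubmx u.
rewrite mul_row_col mul_mx_scalar; split=> [fu|[w]].
  have /res_exact0[w u1E] : I ((u1 *m res_aug F) 0 0).
    apply: f_regular.
    have -> : f * (u1 *m res_aug F) 0 0 = ((- u2 *m res_diff F 0) *m res_aug F) 0 0.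
      suff <- : f *: u1 = - u2 *m res_diff F 0 by rewrite -scalemxAl [RHS]mxE.
      by apply/eqP; rewrite -subr_eq0 mulNmx opprK fu.
    by rewrite -mulmxA; apply: (ideal_colM gI); apply: res_aug_diff.
  have /res_exactS[z zE] : (f *: w + u2) *m res_diff F 0 = 0.
    by rewrite mulmxDl -scalemxAl -u1E.
  exists (row_mx (- w) z); rewrite mul_row_block mulmx0 addr0 mulmxN mulNmx opprK.
  by rewrite -u1E -zE mul_mx_scalar scalerN addrA addNr add0r.
rewrite -[w]hsubmxK mul_row_block mulmx0 addr0 mulmxN => /eq_row_mx[-> ->].
rewrite mul_mx_scalar mulmxDl -scalemxAl -mulmxA res_diff_diff mulmx0 addr0.
by rewrite scalerN addNr.
Qed.

Definition cone : graded_free_resolution ideal_add :=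
  @GradedFreeResolution _ _ ideal_add cone_rank cone_deg (res_aug F) cone_diff
    (@res_aug_homog _ _ _ F) cone_diff_homog cone_aug_surj cone_exact0
    (fun i => @cone_exactS i).

Lemma cone_minimal : f@_0%MM = 0 -> minimal_resolution F -> minimal_resolution cone.
Proof.
move=> f0 minF [|i]; rewrite /cone /=.
  by apply: radical_col_mx; [apply: radical_scalar_mx | apply: minF].
apply: radical_col_mx; apply: radical_row_mx.
- by apply: radical_mxN; apply: minF.
- exact: radical_scalar_mx.
- exact: radical_mx0.
- exact: minF.
Qed.

Definition cone_inj i : 'M[S]_(res_rank F i, cone_rank i) :=
  match i with 0 => 1%:M | j.+1 => row_mx 0 1%:M end.

Lemma cone_inj_diff i :
  res_diff F i *m cone_inj i = cone_inj i.+1 *m cone_diff i.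
Proof.
case: i => [|i] /=.
  by rewrite mul_row_col mul0mx add0r mulmx1 mul1mx.
by rewrite mul_row_block mul_mx_row !(mul0mx, mulmx0, mul1mx, mulmx1) !add0r.
Qed.

Lemma cone_inj_aug : cone_inj 0 *m res_aug F = res_aug F.
Proof. by rewrite mul1mx. Qed.

(** A column with a single entry 1 keeps the constant term of the basis vector [c] visible, and the
    property is stable under composition of such inclusions. *)
Lemma cone_inj_col i c : exists c', forall r, cone_inj i r c' = (r == c)%:R.
Proof.
case: i c => [|i] c /=; first by exists c => r; rewrite mxE.
by exists (rshift _ c) => r; rewrite row_mxEr mxE.
Qed.

End Cone.

(** * The horseshoe lemma for a colon ideal *)

Section Horseshoe.
Variables (k : fieldType) (n : nat).
Local Notation S := {mpoly k[n]}.
Local Notation dg F i := (@res_deg _ _ _ F i).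
Variables (I : S -> Prop) (f : S) (e : int).
Hypotheses (gI : graded_ideal I) (hf : homog_of_degree e f).

Definition colon (p : S) : Prop := I (f * p).

Lemma colon_graded : graded_ideal colon.
Proof.
rewrite /colon; split=> [|p q|p q Iq|d p Ip].
- by rewrite mulr0; apply: ideal0.
- by rewrite mulrDr; apply: idealD.
- by rewrite mulrCA; apply: idealMl.
- by have := ideal_hcomp gI (d + e) Ip; rewrite mulrC (hcompM _ _ hf) addrK mulrC.
Qed.

Variables (A : graded_free_resolution (ideal_add I f))
          (B : graded_free_resolution colon).

Definition twist_deg i (c : 'I_(res_rank B i)) : int := dg B i c + e.

(** These are the off-diagonal blocks of the horseshoe differential. A relation of [A] has its
    augmentation in the ideal generated by [I] and [f], hence equal to [f] times some [s] modulo
    [I]; [theta 0] lifts [- s] through [B], and the later blocks extend it as a chain map up to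
    sign. *)
Lemma horseshoe_twist : exists theta : forall i, 'M_(res_rank A i.+1, res_rank B i),
  [/\ forall i, homog_mx (dg A i.+1) (@twist_deg i) (theta i),
      ideal_col I (res_diff A 0 *m res_aug A + f *: (theta 0%N *m res_aug B)) &
      forall i, res_diff A i.+1 *m theta i + theta i.+1 *m res_diff B i = 0].
Proof.
(* [P] is what the next choice needs, [R] what is kept of it. Consecutive blocks meet in one
   equation, so a whole sequence must be chosen. *)
pose P i (t : 'M_(res_rank A i.+1, res_rank B i)) :=
  homog_mx (dg A i.+1) (@twist_deg i) t /\
  forall r, exists w, row r (res_diff A i.+1 *m t) = w *m res_diff B i.
pose R i (t : 'M_(res_rank A i.+1, res_rank B i))
    (t' : 'M_(res_rank A i.+2, res_rank B i.+1)) :=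
  homog_mx (dg A i.+1) (@twist_deg i) t /\
  res_diff A i.+1 *m t + t' *m res_diff B i = 0.
set v := res_diff A 0 *m res_aug A.
have hv r : homog_of_degree (dg A 1 r) (v r 0).
  rewrite mxE; apply: homog_sum => c _.
  by rewrite -[dg A 1 r](subrK (dg A 0 c)); apply: homogM;
    [apply: res_diff_homog | apply: res_aug_homog].
have [s hs Is] : exists2 s : 'cV_(res_rank A 1),
    forall r, homog_of_degree (dg A 1 r - e) (s r 0) & ideal_col I (v - f *: s).
  have /fin_all_exists[q Iq] r := res_aug_diff A r.
  exists (\col_r hcomp (dg A 1 r - e) (q r)).
    by move=> r; rewrite mxE; apply: homog_hcomp.
  move=> r; have := ideal_hcomp gI (dg A 1 r) (Iq r).
  rewrite raddfB /=; have /hcomp_homogE -> := hv r.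
  by rewrite mulrC (hcompM _ _ hf) mulrC !mxE.
have [Y hY IY] := lift_mod_ideal colon_graded hs (@res_aug_homog _ _ _ B)
  (@res_aug_surj _ _ _ B).
have Itheta0 : ideal_col I (v + f *: (- Y *m res_aug B)).
  rewrite mulNmx scalerN; apply: (ideal_col_trans gI Is) => r.
  by rewrite -scalerBr mxE; apply: IY.
have P0 : P 0%N (- Y).
  split.
    apply: homog_mxN => r c; rewrite /twist_deg opprD addrA addrAC.
    exact: hY.
  apply: res_aug_row0 => r; rewrite /colon.
  (* As [res_diff A 1] kills [v], this multiple of [f] is [res_diff A 1] times a column with entries
     in [I]. *)
  have -> : f * ((res_diff A 1 *m - Y) *m res_aug B) r 0 =
     (res_diff A 1 *m (v + f *: (- Y *m res_aug B))) r 0.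
    rewrite mulmxDr mulmxA res_diff_diff mul0mx add0r -mulmxA -scalemxAr.
    by rewrite [RHS]mxE.
  exact: (ideal_colM gI).
have step i t : P i t -> exists2 t', P i.+1 t' & R i t t'.
  move=> [ht lt].
  have [t' ht' tE] := factor_homog
    (homog_mxM (res_diff_homog_mx A i.+1) ht)
    (homog_mx_shift e (res_diff_homog_mx B i)) lt.
  exists (- t'); last by split=> //; rewrite tE mulNmx subrr.
  split; first exact: homog_mxN.
  apply: res_diff_rowS; rewrite mulmxN mulNmx -mulmxA -tE mulmxA.
  by rewrite res_diff_diff mul0mx oppr0.
have [theta theta0 Rtheta] := dependent_choice P0 step.
exists theta; split=> [i||i]; [by case: (Rtheta i) | | by case: (Rtheta i)].
by rewrite theta0.
Qed.

Lemma horseshoe : exists T : graded_free_resolution I,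
  (forall i, res_rank T i = (res_rank A i + res_rank B i)%N) /\
  (forall i t, (exists c, dg T i t = dg A i c) \/ (exists c, dg T i t = dg B i c
    + e)).
Proof.
have [theta [htheta theta0 thetaS]] := horseshoe_twist.
pose rk i := (res_rank A i + res_rank B i)%N.
pose deg i : 'I_(rk i) -> int := dsum (dg A i) (@twist_deg i).
pose aug : 'cV_(rk 0) := col_mx (res_aug A) (f *: res_aug B).
pose diff i : 'M_(rk i.+1, rk i) :=
  block_mx (res_diff A i) (theta i) 0 (res_diff B i).
have aug_homog c : homog_of_degree (deg 0%N c) (aug c 0).
  rewrite /deg /aug; elim/dsumP: c / (dsum _ _ c) => c.
    by rewrite col_mxEu; apply: res_aug_homog.
  rewrite col_mxEd mxE mulrC; apply: homogM => //.
  exact: res_aug_homog.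
have diff_homog i r c : homog_of_degree (deg i.+1 r - deg i c) (diff i r c).
  apply: homog_block_mx; [exact: res_diff_homog_mx | by [] | exact: homog_mx0 |].
  exact/homog_mx_shift/res_diff_homog_mx.
have aug_surj p : exists u : 'rV_(rk 0), I (p - (u *m aug) 0 0).
  have [u [q Iq]] := res_aug_surj A p; have [v Iv] := res_aug_surj B q.
  exists (row_mx u v);
    rewrite mul_row_col -scalemxAr mxE [fun_of_matrix (f *: _) _ _]mxE.
  have -> : forall a b c : S, a - (b + f * c) = (a - b - f * q) + f * (q - c).
    by move=> a b c; rewrite mulrBr addrA subrK opprD addrA.
  exact: idealD.
have diff_aug : ideal_col I (diff 0%N *m aug).
  rewrite mul_block_col mul0mx add0r -!scalemxAr => r.
  rewrite mxE; case: splitP => j _; first exact: theta0.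
  by rewrite mxE; apply: (res_aug_diff B j).
have exact0 (u : 'rV_(rk 0)) :
    I ((u *m aug) 0 0) <-> exists w, u = w *m diff 0%N.
  split=> [|[w ->]]; last by rewrite -mulmxA; apply: (ideal_colM gI).
  rewrite -[u]hsubmxK; set u1 := lsubmx u; set u2 := rsubmx u.
  rewrite mul_row_col -scalemxAr => Iu.
  have /res_exact0[w wE] : ideal_add I f ((u1 *m res_aug A) 0 0).
    exists (- (u2 *m res_aug B) 0 0); rewrite mulrN opprK.
    by move: Iu; rewrite !mxE.
  have /res_exact0[z zE] : colon (((u2 - w *m theta 0%N) *m res_aug B) 0 0).
    suff : I ((f *: ((u2 - w *m theta 0%N) *m res_aug B)) 0 0) by rewrite mxE.
    have -> : f *: ((u2 - w *m theta 0%N) *m res_aug B) =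
       (u1 *m res_aug A + f *: (u2 *m res_aug B)) - w *m
         (res_diff A 0 *m res_aug A + f *: (theta 0%N *m res_aug B)).
      rewrite mulmxBl scalerBr wE mulmxDr -(scalemxAr f w).
      rewrite -[in RHS](mulmxA w (res_diff A 0)) -(mulmxA w (theta 0%N)).
      move: (w *m (res_diff A 0 *m _)) (f *: (u2 *m _)) (f *: (w *m _)) => x y z.
      by rewrite opprD addrACA subrr add0r.
    by apply: (ideal_colB gI); [move=> r; rewrite ord1 | apply: (ideal_colM gI)].
  exists (row_mx w z); rewrite mul_row_block mulmx0 addr0 -wE -zE.
  by rewrite addrC subrK.
have exactS i : exact_mx (diff i.+1) (diff i).
  by apply: exact_block_mx => //; apply: res_exactS.
exists (GradedFreeResolution aug_homog diff_homog aug_surj exact0 exactS).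
split=> // i t /=; rewrite /deg; elim/dsumP: t / (dsum _ _ t) => c.
  by left; exists c.
by right; exists c.
Qed.

End Horseshoe.

(** * Removing one coordinate of a free module *)

Section DropCoordinate.
Variables (k : fieldType) (n : nat) (a : nat) (c : 'I_a).
Local Notation S := {mpoly k[n]}.

(** Multiplying a row by this matrix inserts a zero at position [c]; multiplying by its transpose
    deletes that position. *)
Definition drop_mx : 'M[S]_(a.-1, a) := row' c 1%:M.

Lemma drop_mx_col (v : 'rV[S]_a.-1) : (v *m drop_mx) 0 c = 0.
Proof.
rewrite mxE big1 // => i _; rewrite !mxE eq_sym.
by rewrite (negPf (neq_lift c i)) mulr0.
Qed.

Lemma drop_mx_lift (v : 'rV[S]_a.-1) i : (v *m drop_mx) 0 (lift c i) = v 0 i.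
Proof.
rewrite mxE (bigD1 i) //= !mxE eqxx mulr1 big1 ?addr0 // => j ji.
by rewrite !mxE (inj_eq lift_inj) (negPf ji) mulr0.
Qed.

Lemma mulmx_drop_tr (u : 'rV[S]_a) i : (u *m drop_mx^T) 0 i = u 0 (lift c i).
Proof.
rewrite mxE (bigD1 (lift c i)) //= !mxE eqxx mulr1 big1 ?addr0 // => j ji.
by rewrite !mxE eq_sym (negPf ji) mulr0.
Qed.

Lemma drop_mxK (v : 'rV[S]_a.-1) : v *m drop_mx *m drop_mx^T = v.
Proof. by apply/rowP => i; rewrite mulmx_drop_tr drop_mx_lift. Qed.

Lemma mulmx_drop_trK (u : 'rV[S]_a) :
  u *m drop_mx^T *m drop_mx = u - u 0 c *: delta_mx 0 c.
Proof.
apply/rowP => j; rewrite !mxE eqxx /=; case: (unliftP c j) => [i ->|->].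
  have := drop_mx_lift (u *m drop_mx^T) i; rewrite mxE => ->.
  by rewrite mulmx_drop_tr eq_sym (negPf (neq_lift c i)) mulr0 subr0.
have := drop_mx_col (u *m drop_mx^T); rewrite mxE => ->.
by rewrite eqxx mulr1 subrr.
Qed.

Lemma delta_drop_tr : delta_mx 0 c *m drop_mx^T = 0 :> 'rV_a.-1.
Proof.
apply/rowP => i; rewrite mulmx_drop_tr !mxE eqxx /= eq_sym.
by rewrite (negPf (neq_lift c i)).
Qed.

Lemma homog_drop_mx (da : 'I_a -> int) : homog_mx (da \o lift c) da drop_mx.
Proof.
move=> i j; rewrite !mxE /=; case: eqP => [->|_]; last exact: homog0.
by rewrite subrr; apply: (@homogC _ _ 1).
Qed.

Lemma homog_drop_tr (da : 'I_a -> int) : homog_mx da (da \o lift c) drop_mx^T.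
Proof.
move=> i j; rewrite !mxE /=; case: eqP => [->|_]; last exact: homog0.
by rewrite subrr; apply: (@homogC _ _ 1).
Qed.

End DropCoordinate.

(** * Existence of minimal resolutions *)

Section Minimization.
Variables (k : fieldType) (n : nat).
Local Notation S := {mpoly k[n]}.
Local Notation dg F i := (@res_deg _ _ _ F i).

Record submodule a (Z : 'rV[S]_a -> Prop) : Prop := Submodule {
  submodule0 : Z 0;
  submoduleD : forall u v, Z u -> Z v -> Z (u + v);
  submoduleZ : forall p u, Z u -> Z (p *: u) }.

Lemma submodule_comp a b (Z : 'rV[S]_a -> Prop) (P : 'M_(b, a)) :
  submodule Z -> submodule (fun v => Z (v *m P)).
Proof.
case=> Z0 ZD ZZ; split=> [|u v|p u]; first by rewrite mul0mx.
  by rewrite mulmxDl; apply: ZD.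
by rewrite -scalemxAl; apply: ZZ.
Qed.

(* Z has a graded free resolution of length at most N, its ambient free module
   having basis degrees da. *)
Fixpoint finres (N a : nat) (da : 'I_a -> int) (Z : 'rV[S]_a -> Prop) : Prop :=
  match N with
  | 0 => forall u, Z u -> u = 0
  | N'.+1 => exists a' (da' : 'I_a' -> int) (M : 'M_(a', a)),
      [/\ homog_mx da' da M, forall u, Z u <-> exists w, u = w *m M &
          finres N' da' (fun w => w *m M = 0)]
  end.

Lemma finres_ext N a (da : 'I_a -> int) (Z Z' : 'rV[S]_a -> Prop) :
  (forall u, Z u <-> Z' u) -> finres N da Z -> finres N da Z'.
Proof.
case: N => [|N] ZZ' /=; first by move=> Z0 u /ZZ'; apply: Z0.
move=> [a' [da' [M [hM ZM fM]]]]; exists a', da', M; split=> // u.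
by rewrite -ZZ'.
Qed.

Lemma scale_col_row (w : 'cV[S]_1) a (q : 'rV[S]_a) : w *m q = w 0 0 *: q.
Proof. by rewrite {1}[w]mx11_scalar mul_scalar_mx. Qed.

(* The constant entry M r c cancels the c-th basis vector against the r-th
   relation. *)
Lemma finres_drop N a (da : 'I_a -> int) (Z : 'rV[S]_a -> Prop)
    a' (da' : 'I_a' -> int) (M : 'M_(a', a)) r c :
  submodule Z -> homog_mx da' da M -> (forall u, Z u <-> exists w, u = w *m M) ->
  finres N da' (fun w => w *m M = 0) -> (M r c)@_0%MM != 0 ->
  finres N.+1 (da \o lift c) (fun v => Z (v *m drop_mx k n c)) /\
  forall u, exists v, Z (u - v *m drop_mx k n c).
Proof.
move=> subZ hM ZM fM Mrc0.
have degrc : da' r = da c by apply/eqP; rewrite -subr_eq0 (homog_const (hM r c)).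
have MrcE : M r c = ((M r c)@_0%MM)%:MP.
  by apply: homog_deg0; have := hM r c; rewrite degrc subrr.
pose s : S := ((M r c)@_0%MM)^-1%:MP.
have sM : s * M r c = 1 by rewrite MrcE -mpolyCM mulVf.
(* An element of [Z] with entry 1 at [c]: modulo [Z], subtracting [u 0 c *: q] clears coordinate [c]
   of [u]. *)
pose q := s *: row r M.
have qc : q 0 c = 1 by rewrite !mxE.
have dropq (v : 'rV_a) : (v - v 0 c *: q) 0 c = 0.
  have -> : (v - v 0 c *: q) 0 c = v 0 c - v 0 c * q 0 c by rewrite !mxE.
  by rewrite qc mulr1 subrr.
have Zq : Z q by apply: submoduleZ => //; apply/ZM; exists (delta_mx 0 r);
  rewrite rowE.
pose E := M - col c M *m q.
have mulE (w : 'rV_a') : w *m E = w *m M - (w *m M) 0 c *: q.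
  rewrite mulmxBr mulmxA scale_col_row; congr (_ - _ *: _).
  by rewrite !mxE; apply: eq_bigr => t _; rewrite mxE.
have hE : homog_mx da' da E.
  move=> i j; rewrite mxE; apply: homogD; first exact: hM.
  rewrite mxE; apply: homogN; rewrite mxE big_ord1 !mxE.
  rewrite -(subrKA (da c)); apply: homogM; first exact: hM.
  rewrite -[X in homog_of_degree X]add0r; apply: homogM; first exact: homogC.
  by rewrite -degrc; apply: hM.
have Er : delta_mx 0 r *m E = 0 :> 'rV_a.
  by rewrite mulE -rowE mxE scalerA [M r c * s]mulrC sM scale1r subrr.
have Ec (w : 'rV_a') : (w *m E) 0 c = 0.
  by rewrite mulE dropq.
pose R := drop_mx k n r; pose Q := drop_mx k n c.
have EQ (w : 'rV_a') : w *m E *m Q^T *m Q = w *m E.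
  by rewrite mulmx_drop_trK Ec scale0r subr0.
have RE (w : 'rV_a') : w *m R^T *m R *m E = w *m E.
  by rewrite mulmx_drop_trK mulmxBl -scalemxAl Er scaler0 subr0.
have kerE (w : 'rV_a'.-1) : w *m (R *m E *m Q^T) = 0 -> w *m R *m E = 0.
  by move=> w0; rewrite -EQ; move: w0; rewrite !mulmxA => ->; rewrite mul0mx.
split; last first.
  move=> u; exists ((u - u 0 c *: q) *m Q^T); rewrite mulmx_drop_trK.
  by rewrite dropq scale0r subr0 subKr; apply: submoduleZ.
exists a'.-1, (da' \o lift r), (R *m E *m Q^T); split.
- apply: homog_mxM; last exact: homog_drop_tr.
  by apply: homog_mxM hE; apply: homog_drop_mx.
- move=> v; split=> [/ZM[w wE]|[w ->]].
    exists (w *m R^T); rewrite 2!mulmxA RE mulE -wE.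
    by rewrite drop_mx_col scale0r subr0 drop_mxK.
  rewrite 2!mulmxA EQ mulE -scaleNr; apply: submoduleD => //.
    by apply/ZM; exists (w *m R).
  exact: submoduleZ.
have ker_lift (w : 'rV_a'.-1) : w *m (R *m E *m Q^T) = 0 ->
    exists t, (w *m R - t *: delta_mx 0 r) *m M = 0.
  move=> /kerE; rewrite mulE => /eqP; rewrite subr_eq0 => /eqP wRM.
  exists ((w *m R *m M) 0 c * s).
  by rewrite mulmxBl -scalemxAl -rowE -scalerA -wRM subrr.
have drop_lift (w : 'rV_a'.-1) t : w = (w *m R - t *: delta_mx 0 r) *m R^T.
  by rewrite mulmxBl -scalemxAl delta_drop_tr scaler0 subr0 drop_mxK.
case: N fM => [|N] /= => [fM w /ker_lift[t /fM wt]|].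
  by rewrite (drop_lift w t) wt mul0mx.
move=> [a2 [da2 [M2 [hM2 kerM2 fM2]]]].
exists a2, da2, (M2 *m R^T); split.
- by apply: homog_mxM hM2 _; apply: homog_drop_tr.
- move=> w; split=> [/ker_lift[t /kerM2[x xE]]|[x ->]].
    by exists x; rewrite mulmxA -xE -drop_lift.
  have xM : x *m M2 *m M = 0 by apply/kerM2; exists x.
  by rewrite !mulmxA RE mulE xM mxE scale0r subr0 mul0mx.
apply: finres_ext fM2 => x; rewrite mulmxA; split=> [->|xR].
  by rewrite mul0mx.
(* A syzygy of [M] supported at [r] alone is zero, since entry [c] of its product with [M] is its
   coefficient times the unit [M r c]. So [M2] without column [r] has the same kernel as [M2]. *)
have xE : x *m M2 = (x *m M2) 0 r *: delta_mx 0 r.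
  by apply/eqP; rewrite -subr_eq0 -mulmx_drop_trK xR mul0mx.
have xM : x *m M2 *m M = 0 by apply/kerM2; exists x.
have : (x *m M2 *m M) 0 c = 0 by rewrite xM mxE.
rewrite {1}xE -scalemxAl -rowE mxE [fun_of_matrix (row r M) _ _]mxE => /(congr1
  (fun p => p * s)).
rewrite mul0r -mulrA [M r c * s]mulrC sM mulr1 => x0.
by rewrite xE x0 scale0r.
Qed.

(** Induction on the rank [a]: as long as the presentation of [Z] has an entry with nonzero constant
    term, [finres_drop] removes a basis vector. The last clause keeps [P] onto modulo [Z], so the
    quotient by [Z] is unchanged. *)
Lemma finres_minimize N a (da : 'I_a -> int) (Z : 'rV[S]_a -> Prop) :
  submodule Z -> finres N da Z ->
  exists b (db : 'I_b -> int) (P : 'M_(b, a)),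
  [/\ homog_mx db da P, finres N db (fun v => Z (v *m P)),
      forall v c, Z (v *m P) -> (v 0 c)@_0%MM = 0 &
      forall u, exists v, Z (u - v *m P)].
Proof.
have [m] := ubnP a; elim: m => // m IH in a da Z * => am subZ fZ.
have minimal_case : (forall v c, Z v -> (v 0 c)@_0%MM = 0) -> exists b
    (db : 'I_b -> int) (P : 'M_(b, a)), [/\ homog_mx db da P,
      finres N db (fun v => Z (v *m P)),
      forall v c, Z (v *m P) -> (v 0 c)@_0%MM = 0 &
      forall u, exists v, Z (u - v *m P)].
  move=> minZ; exists a, da, 1%:M; split.
  - move=> i j; rewrite mxE; case: eqP => [->|_]; last exact: homog0.
    by rewrite subrr; apply: (@homogC _ _ 1).
  - by apply: finres_ext fZ => u; rewrite mulmx1.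
  - by move=> v c; rewrite mulmx1; apply: minZ.
  - by move=> u; exists u; rewrite mulmx1 subrr; apply: submodule0.
case: N => [|N] in fZ IH minimal_case *.
  by apply: minimal_case => v c /fZ ->; rewrite mxE mcoeff0.
have [a' [da' [M [hM ZM fM]]]] := fZ.
have [/existsP[r /existsP[c Mrc0]]|] :=
  boolP [exists r, exists c, (M r c)@_0%MM != 0]; last first.
  move=> /existsPn M0; apply: minimal_case => v c /ZM[w ->].
  apply: radical_mulmxr => i j; apply/eqP.
  by have /existsPn/(_ j) := M0 i; rewrite negbK.
have [fR surjR] := finres_drop subZ hM ZM fM Mrc0.
have lt_a : (a.-1 < m)%N by rewrite prednK // (leq_ltn_trans (leq0n c)).
have [b [db [P [hP fP minP surjP]]]] :=
  IH _ _ _ lt_a (submodule_comp (drop_mx k n c) subZ) fR.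
exists b, db, (P *m drop_mx k n c); split.
- by apply: homog_mxM hP _; apply: homog_drop_mx.
- by apply: finres_ext fP => u; rewrite mulmxA.
- by move=> v i; rewrite mulmxA; apply: minP.
move=> u; have [v Zuv] := surjR u; have [w Zvw] := surjP v.
exists w; rewrite -(subrKA (v *m drop_mx k n c)); apply: submoduleD => //.
by rewrite mulmxA -mulmxBl.
Qed.

Lemma submodule_ker a b (M : 'M[S]_(a, b)) : submodule (fun w : 'rV_a => w *m M
  = 0).
Proof.
split=> [|u v Zu Zv|p u Zu]; first by rewrite mul0mx.
  by rewrite mulmxDl Zu Zv addr0.
by rewrite -scalemxAl Zu scaler0.
Qed.

(** The cover [M0] of [Z] is replaced by [P *m M0], where [P] minimizes the kernel of [M0]. Its rows
    lie in [Z], so they are radical by the assumption on [Z]; the new kernel is radical by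
    [finres_minimize], which is the assumption for the next step. *)
Lemma minimal_tail N a (da : 'I_a -> int) (Z : 'rV[S]_a -> Prop) :
  submodule Z -> finres N da Z -> (forall u c, Z u -> (u 0 c)@_0%MM = 0) ->
  exists (rk : nat -> nat) (deg : forall i, 'I_(rk i) -> int)
    (M : 'M[S]_(rk 0, a)) (D : forall i, 'M[S]_(rk i.+1, rk i)),
  [/\ homog_mx (@deg 0) da M /\ radical_mx M,
      forall u, Z u <-> exists w, u = w *m M,
      exact_mx (D 0) M,
      forall i, homog_mx (@deg i.+1) (@deg i) (D i) /\ radical_mx (D i) &
      forall i, exact_mx (D i.+1) (D i)].
Proof.
elim: N => [|N IH] in a da Z * => subZ fZ minZ.
  exists (fun=> 0%N), (fun=> fun=> 0), 0, (fun=> 0).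
  have rV0 (u v : 'rV[S]_0) : u = v by apply/rowP => -[].
  have exact0 c (M : 'M[S]_(0, c)) : exact_mx (0 : 'M_0) M.
    move=> u; split=> [_|[w ->]]; first by exists 0; apply: rV0.
    by rewrite [_ *m 0](rV0 _ 0) mul0mx.
  split=> // [|u|i]; [by split=> -[]| |by split=> -[]].
  split=> [/fZ ->|[w ->]]; first by exists 0; rewrite mulmx0.
  by rewrite mulmx0; apply: submodule0.
have [a' [da' [M0 [hM0 ZM0 /(finres_minimize (submodule_ker M0))]]]] := fZ.
move=> [b [db [P [hP fP minP surjP]]]].
have [] := IH b db (fun v => v *m P *m M0 = 0) _ fP minP.
  exact: (submodule_comp _ (submodule_ker M0)).
move=> rk [deg [M [D [[hM radM] ZM DM hD exD]]]].
have ZPM u : Z u <-> exists w, u = w *m (P *m M0).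
  split=> [/ZM0[w ->]|[w ->]]; last by apply/ZM0; exists (w *m P); rewrite mulmxA.
  have [v /eqP] := surjP w; rewrite mulmxBl subr_eq0 => /eqP ->.
  by exists v; rewrite mulmxA.
pose rk' i := if i is j.+1 then rk j else b.
pose deg' i : 'I_(rk' i) -> int :=
  match i with 0 => db | j.+1 => deg j end.
pose D' i : 'M[S]_(rk' i.+1, rk' i) :=
  match i with 0 => M | j.+1 => D j end.
exists rk', deg', (P *m M0), D'.
split=> [| |u|[|i]|[|i]] //.
- split; first exact: homog_mxM hP hM0.
  move=> r c; have -> : (P *m M0) r c = (row r (P *m M0)) 0 c by rewrite [RHS]mxE.
  by apply: minZ; apply/ZPM; exists (delta_mx 0 r); rewrite rowE.
- by rewrite mulmxA; apply: ZM.
- exact: hD.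
- exact: exD.
Qed.

Lemma finres_of_resolution (I : S -> Prop) (F : graded_free_resolution I) N :
  (forall i, (N < i)%N -> res_rank F i = 0%N) ->
  forall M i, (N < i + M)%N ->
  finres M (dg F i.+1) (fun u => u *m res_diff F i = 0).
Proof.
move=> F0; elim=> [|M IH] i NiM /=.
  move=> u _; rewrite addn0 in NiM; have rk0 := F0 i.+1 (leqW NiM).
  by apply/rowP => j; have := ltn_ord j; rewrite {2}rk0.
exists (res_rank F i.+2), (dg F i.+2), (res_diff F i.+1); split.
- exact: res_diff_homog_mx.
- exact: res_exactS.
- by apply: IH; rewrite addSnnS.
Qed.

Theorem minimal_resolution_exists (I : S -> Prop) (F : graded_free_resolution I) N :
  graded_ideal I -> (forall i, (N < i)%N -> res_rank F i = 0%N) ->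
  exists F' : graded_free_resolution I, minimal_resolution F'.
Proof.
move=> gI F0.
have subI : submodule (fun u : 'rV_(res_rank F 0) => I ((u *m res_aug F) 0 0)).
  split=> [|u v Iu Iv|p u Iu]; first by rewrite mul0mx mxE; apply: ideal0.
    by rewrite mulmxDl mxE; apply: idealD.
  by rewrite -scalemxAl mxE; apply: idealMl.
(* One step for [res_diff F 0], and [N.+1] more to reach a kernel inside a module of rank 0. *)
have fI : finres N.+2 (dg F 0)
    (fun u : 'rV_(res_rank F 0) => I ((u *m res_aug F) 0 0)).
  exists (res_rank F 1), (dg F 1), (res_diff F 0); split.
  - exact: res_diff_homog_mx.
  - exact: res_exact0.
  - exact: finres_of_resolution F0 _ _ _.
have [b [db [P [hP fP minP surjP]]]] := finres_minimize subI fI.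
have [] := minimal_tail _ fP minP; first exact: (submodule_comp P subI).
move=> rk [deg [M [D [[hM radM] ZM DM hD exD]]]].
pose rk' i := if i is j.+1 then rk j else b.
pose deg' i : 'I_(rk' i) -> int :=
  match i with 0 => db | j.+1 => deg j end.
pose D' i : 'M[S]_(rk' i.+1, rk' i) :=
  match i with 0 => M | j.+1 => D j end.
have aug_homog c : homog_of_degree (deg' 0%N c) ((P *m res_aug F) c 0).
  rewrite mxE; apply: homog_sum => t _.
  rewrite -[deg' 0%N c](subrK (dg F 0 t)); apply: homogM.
    exact: hP.
  exact: res_aug_homog.
have diff_homog i r c : homog_of_degree (deg' i.+1 r - deg' i c) (D' i r c).
  by case: i r c => [|i]; [apply: hM | case: (hD i)].
have aug_surj p : exists u : 'rV_(rk' 0), I (p - (u *m (P *m res_aug F)) 0 0).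
  have [u Iu] := res_aug_surj F p; have [v Iv] := surjP u.
  exists v; rewrite -(subrKA ((u *m res_aug F) 0 0)); apply: idealD => //.
  by move: Iv; rewrite mulmxBl mulmxA mxE [X in _ + X]mxE.
have exact0 (u : 'rV_(rk' 0)) :
    I ((u *m (P *m res_aug F)) 0 0) <-> exists w, u = w *m D' 0%N.
  by rewrite mulmxA; apply: ZM.
have exactS i : exact_mx (D' i.+1) (D' i) by case: i.
exists (GradedFreeResolution aug_homog diff_homog aug_surj exact0 exactS).
by case=> [|i] /= r c; [apply: radM | case: (hD i)].
Qed.

End Minimization.

(** * Monomial ideals and Koszul complexes *)

Section MonomialIdeals.
Variables (k : fieldType) (n : nat).
Local Notation S := {mpoly k[n]}.
Local Notation dg F i := (@res_deg _ _ _ F i).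
Implicit Types (D : pred 'X_{1..n}) (f g m : 'X_{1..n}).

(** A monomial ideal is encoded by its set of exponents, so that adding a monomial and taking the
    colon by one become operations on predicates ([ideal_add_mono], [colon_mono]). *)
Definition mono_ideal D (p : S) : Prop := forall m, m \in msupp p -> D m.

Definition upclosed D := forall m m', D m -> D (m + m')%MM.

Lemma mono_ideal_graded D : upclosed D -> graded_ideal (mono_ideal D).
Proof.
move=> upD; split=> [m|p q Ip Iq m|p q Iq m|d p Ip m].
- by rewrite msupp0.
- by move=> /msuppD_le; rewrite mem_cat => /orP[/Ip|/Iq].
- move=> /msuppM_le /allpairsP[[m1 m2] /= [_ /Iq Dm2 ->]].
  by rewrite addmC; apply: upD.
rewrite mcoeff_msupp mcoeff_hcomp; case: ifP => _; last by rewrite eqxx.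
by rewrite -mcoeff_msupp => /Ip.
Qed.

Lemma mono_idealX D m : D m -> mono_ideal D 'X_[m].
Proof. by move=> Dm m'; rewrite msuppX inE => /eqP->. Qed.

Lemma mono_ideal_ind (I : S -> Prop) D :
  graded_ideal I -> (forall m, D m -> I 'X_[m]) ->
  forall p, mono_ideal D p -> I p.
Proof.
move=> gI DI p Ip; rewrite [p]mpolyE big_seq; elim/big_ind: _ => [|q r|m].
- exact: ideal0.
- exact: idealD.
- by move=> /Ip Dm; rewrite -mul_mpolyC; apply: (idealMl gI); apply: DI.
Qed.

Lemma ideal_add_graded (I : S -> Prop) (f : S) e :
  graded_ideal I -> homog_of_degree e f -> graded_ideal (ideal_add I f).
Proof.
move=> gI hf; split=> [|p q [a Ia] [b Ib]|p q [a Ia]|d p [a Ia]].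
- by exists 0; rewrite mulr0 subr0; apply: ideal0.
- by exists (a + b); rewrite mulrDr opprD addrACA; apply: idealD.
- by exists (p * a); rewrite mulrCA -mulrBr; apply: idealMl.
exists (hcomp (d - e) a).
by rewrite mulrC -(hcompM _ _ hf) -raddfB mulrC; apply: ideal_hcomp.
Qed.

Lemma ideal_add_mono D f : upclosed D -> forall p,
  ideal_add (mono_ideal D) 'X_[f] p <->
  mono_ideal (fun m => D m || (f <= m)%MM) p.
Proof.
move=> upD p; have gD := mono_ideal_graded upD; split=> [[q Iq]|].
  have up' : upclosed (fun m => D m || (f <= m)%MM).
    move=> m m' /orP[/upD->//|fm]; apply/orP; right.
    by apply: (lepm_trans fm); apply: lem_addr.
  rewrite -(subrK ('X_[f] * q) p); apply: (idealD (mono_ideal_graded up')).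
    by move=> m /Iq ->.
  rewrite mulrC; apply: (idealMl (mono_ideal_graded up')); apply: mono_idealX.
  by rewrite lepm_refl orbT.
apply: (@mono_ideal_ind (ideal_add (mono_ideal D) 'X_[f]));
  first exact: (ideal_add_graded gD (@homogX k n f)).
move=> m /orP[Dm|fm].
  by exists 0; rewrite mulr0 subr0; apply: mono_idealX.
by exists 'X_[m - f]; rewrite -mpolyXD addmC submK // subrr; apply: ideal0.
Qed.

Lemma colon_mono D f p :
  colon (mono_ideal D) 'X_[f] p <-> mono_ideal (fun m => D (f + m)%MM) p.
Proof.
rewrite /colon mulrC; split=> Ip m.
  by rewrite mcoeff_msupp -(mcoeffMX p f m) -mcoeff_msupp => /Ip.
rewrite (perm_mem (msuppMX p f)) => /mapP[m' pm' ->].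
by apply: Ip.
Qed.

(** Kept transparent: later proofs use that ranks, degrees and differentials of the copy are
    convertible to those of [F]. *)
Definition resolution_ext (I J : S -> Prop) (IJ : forall p, I p <-> J p)
    (F : graded_free_resolution I) : graded_free_resolution J.
Proof.
apply: (@GradedFreeResolution _ _ J (res_rank F) (@res_deg _ _ _ F) (res_aug F)
  (res_diff F)).
- exact: res_aug_homog.
- exact: res_diff_homog.
- by move=> p; have [u /IJ] := res_aug_surj F p; exists u.
- by move=> u; rewrite -IJ; apply: res_exact0.
- exact: res_exactS.
Defined.

Lemma zero_resolution : exists F : graded_free_resolution (mono_ideal pred0),
  [/\ minimal_resolution F, forall i, res_rank F i = (i == 0%N) &
      forall i c, dg F i c = 0].
Proof.
have rV0 (u v : 'rV[S]_0) : u = v by apply/rowP => -[].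
have Izero (p : S) : mono_ideal pred0 p <-> p = 0.
  split=> [Ip|-> m]; last by rewrite msupp0.
  by apply/msuppnil0; move: Ip; rewrite /mono_ideal;
    case: (msupp p) => // m s /(_ m (mem_head _ _)).
unshelve eexists (@GradedFreeResolution _ _ (mono_ideal pred0)
  (fun i => (i == 0%N) : nat) (fun _ _ => 0) 1%:M (fun i => 0) _ _ _ _ _).
- by move=> c; rewrite !ord1 mxE; apply: (@homogC _ _ 1).
- by move=> i [].
- by move=> p; exists p%:M; rewrite mulmx1 mxE subrr; apply/Izero.
- move=> u; rewrite mulmx1 Izero; split=> [u0|[w ->]]; last by rewrite mulmx0 mxE.
  by exists 0; rewrite mulmx0; apply/rowP => j; rewrite !ord1 u0 mxE.
- by move=> i u; split=> [_|_]; [exists 0; apply: rV0 | rewrite mulmx0].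
by split=> // i [].
Qed.

(** The condition on [f + m] says that the monomial [f] is a nonzerodivisor modulo [D]. [T] is the
    cone over [F], and [alpha] the inclusion of [F] in it. *)
Lemma mono_cone D D' f (F : graded_free_resolution (mono_ideal D)) :
    upclosed D -> (forall m, D (f + m)%MM -> D m) ->
    (forall m, D' m = D m || (f <= m)%MM) ->
  exists (T : graded_free_resolution (mono_ideal D'))
      (alpha : forall i, 'M_(res_rank F i, res_rank T i)),
  [/\ f != 0%MM -> minimal_resolution F -> minimal_resolution T,
      alpha 0%N *m res_aug T = res_aug F /\
        forall i, res_diff F i *m alpha i = alpha i.+1 *m res_diff T i,
      forall i c, exists c', forall r, alpha i r c' = (r == c)%:R,
      (forall i c, exists c', dg T i.+1 c' = dg F i c + (mdeg f)%:Z) &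
      (forall i, res_rank T i.+1 = res_rank F i + res_rank F i.+1)%N /\
      (forall i t, (exists c, dg T i t = dg F i c) \/
         (exists j c, i = j.+1 /\ dg T i t = dg F j c + (mdeg f)%:Z))].
Proof.
move=> upD regD D'E; have gD := mono_ideal_graded upD.
have regf p : mono_ideal D ('X_[f] * p) -> mono_ideal D p.
  by move=> /colon_mono Ip m /Ip /regD.
have JE p : ideal_add (mono_ideal D) 'X_[f] p <-> mono_ideal D' p.
  by rewrite ideal_add_mono //; split=> Ip m /Ip; rewrite D'E.
exists (resolution_ext JE (cone F gD (@homogX k n f) regf)), (cone_inj F).
split=> [f0 minF|||i c|].
- apply: cone_minimal => //.
  by rewrite mcoeffX (negPf f0).
- by split; [apply: cone_inj_aug | apply: cone_inj_diff].
- exact: cone_inj_col.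
- by exists (lshift _ c); rewrite /= dsum_lshift.
split=> // -[|i] t; first by left; exists t.
rewrite /=; elim/dsumP: t / (dsum _ _ t) => c; last by left; exists c.
by right; exists i, c.
Qed.

Definition coprime_mnm f g := [forall i, (f i == 0%N) || (g i == 0%N)].
Definition dvd_some (fs : seq 'X_{1..n}) m := has (fun f => f <= m)%MM fs.

Lemma dvd_some_up fs : upclosed (dvd_some fs).
Proof.
move=> m m' /hasP[f fsf fm]; apply/hasP; exists f => //.
by apply: (lepm_trans fm); apply: lem_addr.
Qed.

Lemma dvd_some_regular f fs m :
  all (coprime_mnm f) fs -> dvd_some fs (f + m)%MM -> dvd_some fs m.
Proof.
move=> /allP cop /hasP[g fsg /mnm_lepP gfm]; apply/hasP; exists g => //.
apply/mnm_lepP => i; have := gfm i; rewrite mnmDE.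
by have /forallP/(_ i)/orP[/eqP->//|/eqP->] := cop g fsg.
Qed.

(** Iterated cones: by disjointness of supports each monomial is regular modulo those after it, and
    its cone adds a top basis vector shifted by its degree. Excluding the monomial 1 keeps the
    differentials radical. The last clause, for variables, is regularity 0. *)
Lemma koszul_resolution fs : pairwise coprime_mnm fs -> 0%MM \notin fs ->
  exists K : graded_free_resolution (mono_ideal (dvd_some fs)),
  [/\ minimal_resolution K,
      exists c, dg K (size fs) c = (\sum_(f <- fs) mdeg f)%N%:Z,
      forall i, (size fs < i)%N -> res_rank K i = 0%N &
      (forall f, f \in fs -> mdeg f = 1%N) ->
        forall i c, dg K i c <= i%:Z].
Proof.
elim: fs => [|f fs IH] /=.
  move=> _ _; have [F [minF rkF degF]] := zero_resolution; exists F; split=> //.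
  - have c0 : 'I_(res_rank F 0) by rewrite rkF; apply: ord0.
    by exists c0; rewrite degF big_nil.
  - by move=> [|i] // _; rewrite rkF.
  - by move=> _ i c; rewrite degF.
move=> /andP[copf cop]; rewrite inE negb_or eq_sym => /andP[f0 fs0].
have [K [minK [c0 degc0] rkK linK]] := IH cop fs0.
have [|||T [_ [minT _ _ degT [rkT degT']]]] := @mono_cone _ (dvd_some (f :: fs))
  f K.
- exact: dvd_some_up.
- by move=> m; apply: dvd_some_regular.
- by move=> m; rewrite orbC.
exists T; split=> [||[|i]|lin i t] //.
- exact: minT.
- have [c' c'E] := degT _ c0; exists c'.
  by rewrite c'E degc0 big_cons addnC PoszD.
- by move=> lti; rewrite rkT !rkK // ltnW.
have linK' : forall i c, dg K i c <= i%:Z.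
  by apply: linK => g gfs; apply: lin; rewrite inE gfs orbT.
case: (degT' i t) => [[c ->]|[j [c [ij ->]]]] //.
suff -> : i%:Z = j%:Z + (mdeg f)%:Z by rewrite lerD2r.
by rewrite lin ?mem_head // ij -addn1 PoszD.
Qed.

(** Further cones over [gs] contain [K] as a subcomplex whose basis vectors remain basis vectors;
    this is how the top Koszul class survives. *)
Lemma koszul_extend fs gs (K : graded_free_resolution (mono_ideal (dvd_some fs))) :
    pairwise coprime_mnm (gs ++ fs) -> 0%MM \notin gs -> minimal_resolution K ->
  exists (T : graded_free_resolution (mono_ideal (dvd_some (gs ++ fs))))
      (alpha : forall i, 'M_(res_rank K i, res_rank T i)),
  [/\ minimal_resolution T, alpha 0%N *m res_aug T = res_aug K,
      forall i, res_diff K i *m alpha i = alpha i.+1 *m res_diff T i &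
      forall i c, exists c', forall r, alpha i r c' = (r == c)%:R].
Proof.
move=> + + minK; elim: gs => [|g gs IH] /=.
  move=> _ _; exists K, (fun=> 1%:M); split=> // [|i|i c].
  - by rewrite mul1mx.
  - by rewrite mulmx1 mul1mx.
  - by exists c => r; rewrite mxE.
move=> /andP[copg cop]; rewrite inE negb_or eq_sym => /andP[g0 gs0].
have [T [alpha [minT alpha0 alphaS alphaI]]] := IH cop gs0.
have [|||T' [beta [minT' [beta0 betaS] betaI _ _]]] :=
  @mono_cone _ (dvd_some (g :: gs ++ fs)) g T.
- exact: dvd_some_up.
- by move=> m; apply: dvd_some_regular.
- by move=> m; rewrite orbC.
exists T', (fun i => alpha i *m beta i); split=> [||i|i c].
- exact: minT'.
- by rewrite -mulmxA beta0.
- by rewrite mulmxA alphaS -mulmxA betaS mulmxA.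
have [c1 c1E] := alphaI i c; have [c2 c2E] := betaI i c1; exists c2 => r.
rewrite mxE (bigD1 c1) //= c2E eqxx mulr1 c1E big1 ?addr0 // => j jc1.
by rewrite c2E (negPf jc1) mulr0.
Qed.

Lemma betti_complete_intersection (I : S -> Prop) (F : graded_free_resolution I)
    fs gs :
    graded_ideal I -> pairwise coprime_mnm (gs ++ fs) -> 0%MM \notin gs ++ fs ->
    (forall p, mono_ideal (dvd_some fs) p -> I p) ->
    (forall p, I p -> mono_ideal (dvd_some (gs ++ fs)) p) ->
  exists c, dg F (size fs) c = (\sum_(f <- fs) mdeg f)%N%:Z.
Proof.
move=> gI cop; rewrite mem_cat negb_or => /andP[gs0 fs0] KI IC.
have cop' : pairwise coprime_mnm fs.
  by move: cop; rewrite pairwise_cat => /and3P[].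
have [K [minK [c0 degc0] _ _]] := koszul_resolution cop' fs0.
have [C [alpha [minC alpha0 alphaS alphaI]]] := koszul_extend cop gs0 minK.
have [c cE] := alphaI _ c0; have gC := mono_ideal_graded (@dvd_some_up (gs ++ fs)).
have [||b bE] := betti_between F gI gC KI IC minK minC _ alphaS (r := c0) (c := c).
- by rewrite alpha0 subrr => r; rewrite mxE; apply: ideal0.
- by rewrite cE eqxx mcoeff1 eqxx oner_neq0.
by exists b; rewrite bE.
Qed.

End MonomialIdeals.

(** * Excluded cycles, shedding vertices and induced matchings *)

Section Graphs.
Variable G : sgraph.
Implicit Types (a b c d x y z u v : G).

Lemma not_cycle_free n (f : 'I_n -> G) :
  injective f -> (forall i j, adj (f i) (f j) = cycle_adj i j) -> ~ cycle_free n G.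
Proof.
move=> f_inj fE; apply; pose U := f @: setT.
have fU i : f i \in U by apply: imset_f.
pose h i : induced U := exist _ (f i) (fU i).
have h_inj : injective h by move=> i j [/f_inj].
have [|g hK gK] := inj_card_bij h_inj.
  by rewrite card_sig card_imset // cardsT.
exists g; first by exists h.
by move=> u v; rewrite -[in RHS](gK u) -[in RHS](gK v) /adj /= /induced_adj /= fE.
Qed.

Lemma no_induced_C4 a b c d : cycle_free 4 G ->
  adj a b -> adj b c -> adj c d -> adj d a -> ~~ adj a c -> ~~ adj b d ->
  a != c -> b != d -> False.
Proof.
move=> C4 ab bc cd da /negbTE ac /negbTE bd nac nbd.
have neq u v : adj u v -> u != v.
  by move=> uv; apply: contraTneq uv => ->; rewrite adj_irr.
pose s := [:: a; b; c; d].
have us : uniq s.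
  by rewrite /= !inE !negb_or nac nbd (neq _ _ ab) (neq _ _ bc) (neq _ _ cd)
    eq_sym (neq _ _ da).
apply: (@not_cycle_free 4 (fun i => nth a s i)) C4.
  by move=> i j /eqP; rewrite nth_uniq // => /eqP/val_inj.
have [ba cb dc ad] : [/\ adj b a, adj c b, adj d c & adj a d].
  by split; rewrite adj_sym.
have [ca db] : adj c a = false /\ adj d b = false.
  by split; rewrite adj_sym.
move=> [[|[|[|[|//]]]] i] [[|[|[|[|//]]]] j]; rewrite /cycle_adj -!val_eqE /=;
  by rewrite ?adj_irr.
Qed.

Lemma no_induced_C5 a b c d e : cycle_free 5 G ->
  adj a b -> adj b c -> adj c d -> adj d e -> adj e a ->
  ~~ adj a c -> ~~ adj b d -> ~~ adj c e -> ~~ adj d a -> ~~ adj e b -> False.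
Proof.
move=> C5 ab bc cd de ea nac nbd nce nda neb.
have neq u v : adj u v -> u != v.
  by move=> uv; apply: contraTneq uv => ->; rewrite adj_irr.
pose s := [:: a; b; c; d; e].
have [ba cb dc ed ae] : [/\ adj b a, adj c b, adj d c, adj e d & adj a e].
  by split; rewrite adj_sym.
have us : uniq s.
  rewrite /= !inE !negb_or (neq _ _ ab) (neq _ _ bc) (neq _ _ cd) (neq _ _ de)
    (neq _ _ ae) /= !andbT.
  apply/and3P; split; [apply/andP; split|apply/andP; split|].
  - by apply: contraNneq nda => ->; rewrite dc.
  - by apply: contraNneq nac => ->; rewrite dc.
  - by apply: contraNneq neb => ->; rewrite ed.
  - by apply: contraNneq nbd => ->; rewrite ed.
  by apply: contraNneq nac => ->; rewrite ae.
apply: (@not_cycle_free 5 (fun i => nth a s i)) C5.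
  by move=> i j /eqP; rewrite nth_uniq // => /eqP/val_inj.
have [[ca db ec ad be] [ac bd ce da eb]] :
    [/\ adj c a = false, adj d b = false, adj e c = false, adj a d = false &
     adj b e = false] /\ [/\ adj a c = false, adj b d = false, adj c e = false,
     adj d a = false & adj e b = false].
  by split; split; apply/negbTE; rewrite // adj_sym.
move=> [[|[|[|[|[|//]]]]] i] [[|[|[|[|[|//]]]]] j]; rewrite /cycle_adj -!val_eqE /=;
  by rewrite ?adj_irr.
Qed.

Lemma independentP (S : {set G}) :
  reflect {in S &, forall u v, ~~ adj u v} (independent S).
Proof.
apply: (iffP forall_inP) => [H u v uS vS|H u uS].
  by have /forall_inP := H u uS; apply.
by apply/forall_inP => v vS; apply: H.
Qed.

(* Otherwise every neighbour of x has a neighbour outside N[x].  Among the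
   independent sets outside N[x] take one dominating as many neighbours of x as
   possible; exchanging for a missed neighbour v a vertex b of N(v) \ N[x] loses
   no dominated vertex, by (C4, C5)-freeness. *)
Lemma shedding_dominated x :
    (forall a b c d : G, adj a b -> adj b c -> adj c d -> adj d a ->
       ~~ adj a c -> ~~ adj b d -> a != c -> b != d -> False) ->
    (forall a b c d e : G, adj a b -> adj b c -> adj c d -> adj d e -> adj e a ->
       ~~ adj a c -> ~~ adj b d -> ~~ adj c e -> ~~ adj d a -> ~~ adj e b ->
         False) ->
  shedding x ->
  exists2 y, adj x y & forall z, adj y z -> z \in closed_nbhd x.
Proof.
move=> C4 C5 shx.
have [/existsP[y /andP[xy /forallP yz]]|none] :=
  boolP [exists y, adj x y && [forall z, adj y z ==> (z \in closed_nbhd x)]].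
  by exists y => // z; apply/implyP.
pose dom (S : {set G}) := [set y | adj x y && [exists s in S, adj y s]].
pose P (S : {set G}) := (S \subset ~: closed_nbhd x) && independent S.
have P0 : P set0 by rewrite /P sub0set; apply/independentP => u v; rewrite inE.
case: (@arg_maxnP _ set0 P (fun S => #|dom S|) P0) => S /andP[Sx indS] maxS.
have [v] := shx S Sx indS; rewrite inE => xv /independentP indvS.
have vS s : s \in S -> ~~ adj v s.
  by move=> sS; apply: indvS; rewrite !inE ?eqxx ?sS ?orbT.
have [b vb bx] : exists2 b, adj v b & b \notin closed_nbhd x.
  move/existsPn/(_ v): none; rewrite xv /= => /forallPn[b].
  by rewrite negb_imply => /andP[]; exists b.
have xS s : s \in S -> s \notin closed_nbhd x.
  by move=> sS; have := subsetP Sx s sS; rewrite inE.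
have outside s : s \notin closed_nbhd x -> s != x /\ ~~ adj x s.
  by rewrite !inE negb_or => /andP[].
pose S' := b |: (S :\: open_nbhd b).
have PS' : P S'.
  apply/andP; split.
    apply/subsetP => s; rewrite in_setC => /setU1P[->//|/setDP[/xS //]].
  apply/independentP => s t /setU1P[->|/setDP[sS bs]] /setU1P[->|/setDP[tS bt]].
  - by rewrite adj_irr.
  - by move: bt; rewrite inE.
  - by move: bs; rewrite inE adj_sym.
  exact: (independentP _ indS).
suff : dom S \proper dom S'.
  by move=> /proper_card; rewrite ltnNge => /negP[]; apply: maxS.
apply/properP; split; last first.
  exists v; rewrite inE xv /=; first by apply/existsP; exists b; rewrite setU11.
  by apply/existsPn => s; apply/negP => /andP[/vS/negPf->].
apply/subsetP => y; rewrite !inE => /andP[xy /existsP[s /andP[sS ys]]].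
rewrite xy /=; apply/existsP.
have [bs|nbs] := boolP (adj b s); last first.
  by exists s; rewrite !inE sS nbs ys orbT.
have [yb|nyb] := boolP (adj y b); first by exists b; rewrite setU11.
have [sx nxs] := outside _ (xS _ sS); have [bx' nxb] := outside _ bx.
(* A dominated [y] lost in the exchange closes the induced 4-cycle [v b s y] if it is adjacent to
   [v], and the induced 5-cycle [x v b s y] otherwise. *)
exfalso; have [vy|nvy] := boolP (adj v y).
  apply: (C4 v b s y) => //.
  - by rewrite adj_sym.
  - by rewrite adj_sym.
  - exact: vS.
  - by rewrite adj_sym.
  - by apply: contraNneq nxs => <-.
  - by apply: contraNneq nxb => ->.
apply: (C5 x v b s y) => //.
- by rewrite adj_sym.
- by rewrite adj_sym.
- exact: vS.
- by rewrite adj_sym.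
- by rewrite adj_sym.
by rewrite adj_sym.
Qed.

Lemma edgesP (e : {set G}) :
  reflect (exists u v, adj u v /\ e = [set u; v]) (e \in edges G).
Proof.
apply: (iffP imsetP) => [[[u v]]|[u [v [uv ->]]]].
  by rewrite inE /= => uv ->; exists u, v.
by exists (u, v); rewrite ?inE.
Qed.

Lemma induced_matchingP (M : {set {set G}}) :
  reflect [/\ M \subset edges G, trivIset M &
    forall u v, adj u v -> u \in cover M -> v \in cover M -> [set u; v] \in M]
  (induced_matching M).
Proof.
apply: (iffP andP) => [[/andP[Me Mt] /forall_inP H]|[Me Mt H]].
  split=> // u v uv uM vM.
  have eE : [set u; v] \in edges G by apply/edgesP; exists u, v.
  apply: (implyP (H _ eE)); apply/subsetP => w.
  by rewrite !inE => /orP[]/eqP->.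
split; first by rewrite /matching Me.
apply/forall_inP => e /edgesP[u [v [uv ->]]]; apply/implyP => /subsetP sub.
by apply: H => //; apply: sub; rewrite !inE eqxx ?orbT.
Qed.

Lemma im_max (M : {set {set G}}) : induced_matching M -> (#|M| <= im G)%N.
Proof. exact: (@bigop.leq_bigmax_cond _ (@induced_matching G)). Qed.

Lemma im_attained : exists2 M : {set {set G}}, induced_matching M & #|M| = im G.
Proof.
have ind0 : induced_matching (set0 : {set {set G}}).
  apply/induced_matchingP; split; first exact: sub0set.
    by apply/trivIsetP => A B; rewrite inE.
  by move=> u v _; rewrite /cover big_set0 inE.
rewrite /im; elim/big_ind: _ => [|m1 m2 [M1 i1 <-] [M2 i2 <-]|M indM].
- by exists set0; rewrite ?cards0.
- by case: (leqP #|M1| #|M2|) => _; [exists M2 | exists M1].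
by exists M.
Qed.

End Graphs.

(** * Induced matchings of induced subgraphs *)

Section InducedMatchings.
Variables (G : sgraph) (U : {set G}).
Local Notation H := (induced U).
Local Notation push := (fun e : {set H} => val @: e).

Lemma push_inj : injective push.
Proof. exact/imset_inj/val_inj. Qed.

Lemma mem_cover_push (M : {set {set H}}) u :
  reflect (exists2 w : H, w \in cover M & u = val w) (u \in cover (push @: M)).
Proof.
apply: (iffP bigcupP) => [[_ /imsetP[e eM ->] /imsetP[w we ->]]|[w /bigcupP[e eM
  we] ->]].
  by exists w => //; apply/bigcupP; exists e.
by exists (push e); apply: imset_f.
Qed.

Lemma push_pair (u v : H) : push [set u; v] = [set val u; val v].
Proof. by rewrite /= imsetU !imset_set1. Qed.

Lemma induced_matching_push (M : {set {set H}}) :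
  induced_matching M -> induced_matching (push @: M).
Proof.
move=> /induced_matchingP[Me Mt MH]; apply/induced_matchingP; split.
- apply/subsetP => _ /imsetP[e eM ->].
  have /edgesP[u [v [uv ->]]] := subsetP Me e eM.
  by apply/edgesP; exists (val u), (val v); rewrite push_pair.
- apply/trivIsetP => _ _ /imsetP[e eM ->] /imsetP[e' e'M ->] ee'.
  have nee' : e != e' by apply: contraNneq ee' => ->.
  rewrite imset_disjoint; first exact: (trivIsetP Mt).
  exact: val_inj.
move=> u v uv /mem_cover_push[w wM uE] /mem_cover_push[t tM vE].
rewrite {}uE {}vE in uv *; rewrite -push_pair; apply: imset_f.
exact: MH.
Qed.

Lemma im_induced : (im H <= im G)%N.
Proof.
have [M indM <-] := im_attained H.
by rewrite -(card_imset (mem M) push_inj); apply/im_max/induced_matching_push.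
Qed.

End InducedMatchings.

Lemma im_del_nbhd (G : sgraph) (x y : G) :
  adj x y -> (forall z, adj y z -> z \in closed_nbhd x) ->
  (im (del (closed_nbhd x)) < im G)%N.
Proof.
move=> xy ysub; set U := ~: closed_nbhd x.
have [M indM <-] := im_attained (induced U).
pose M' : {set {set G}} := [set val @: e | e : {set induced U} in M].
have /induced_matchingP[Me Mt MH] := induced_matching_push indM.
rewrite -/M' in Me Mt MH.
have M'U u : u \in cover M' -> u \notin closed_nbhd x.
  by move=> /mem_cover_push[w _ ->]; have := valP w; rewrite in_setC.
have xyU : (x \in closed_nbhd x) && (y \in closed_nbhd x).
  by rewrite !inE eqxx xy orbT.
have [xM yM] : x \notin cover M' /\ y \notin cover M'.
  by move/andP: xyU => [xU yU]; split; apply/negP => /M'U; rewrite ?xU ?yU.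
have xyM : [set x; y] \notin M'.
  apply: contra xM => xyM; apply/bigcupP; exists [set x; y] => //.
  by rewrite !inE eqxx.
rewrite -(card_imset (mem M) (@push_inj _ U)) -/M'.
suff ind : induced_matching ([set x; y] |: M').
  by have := im_max ind; rewrite cardsU1 xyM.
have coverE : cover ([set x; y] |: M') = [set x; y] :|: cover M'.
  by rewrite /cover bigcup_setU big_set1.
apply/induced_matchingP; split.
- rewrite subUset sub1set Me andbT; apply/edgesP; by exists x, y.
- apply/trivIsetP => A B /setU1P[->|AM] /setU1P[->|BM] AB.
  + by rewrite eqxx in AB.
  + rewrite disjoint_sym disjoints_subset; apply/subsetP => z zB; rewrite !inE.
    have zM : z \in cover M' by apply/bigcupP; exists B.
    by apply/negP => /orP[]/eqP zE; rewrite zE ?(negPf xM) ?(negPf yM) in zM.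
  + rewrite disjoints_subset; apply/subsetP => z zA; rewrite !inE.
    have zM : z \in cover M' by apply/bigcupP; exists A.
    by apply/negP => /orP[]/eqP zE; rewrite zE ?(negPf xM) ?(negPf yM) in zM.
  exact: (trivIsetP Mt).
(* All neighbours of [x] and of [y] lie in [N[x]], which [M'] avoids; so no edge joins the pair [x],
   [y] to [M']. *)
have key u v : adj u v -> u \in [set x; y] -> v \in cover M' -> False.
  move=> uv; rewrite !inE => /orP[]/eqP uE /M'U; rewrite {u}uE in uv *.
    by rewrite !inE uv orbT.
  by rewrite ysub.
move=> u v uv; rewrite coverE => /setUP[uxy|uM] /setUP[vxy|vM]; apply/setU1P.
- left.
  move: uxy vxy uv; rewrite !inE => /orP[]/eqP-> /orP[]/eqP->;
    rewrite ?adj_irr // => _; exact: setUC.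
- by case: (key u v uv uxy vM).
- by rewrite adj_sym in uv; case: (key v u uv vxy uM).
by right; apply: MH.
Qed.

(** * Edge ideals of induced subgraphs inside one ring *)

Section EdgeIdeals.
Variables (k : fieldType) (G : sgraph).
Local Notation S := {mpoly k[#|G|]}.
Local Notation mnm := 'X_{1..#|G|}.
Local Notation dg F i := (@res_deg _ _ _ F i).
Implicit Types (A B U W : {set G}) (m : mnm) (u v w x y : G).

Definition mset A : mnm := [multinom (enum_val i \in A : nat) | i < #|G|].

Lemma msetE A v : mset A (enum_rank v) = (v \in A).
Proof. by rewrite mnmE enum_rankK. Qed.

Lemma mset_le A m :
  reflect (forall v, v \in A -> (0 < m (enum_rank v))%N) (mset A <= m)%MM.
Proof.
apply: (iffP mnm_lepP) => [le v vA|pos i].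
  by have := le (enum_rank v); rewrite msetE vA.
by rewrite mnmE; case: (boolP (_ \in A)) => // /pos; rewrite enum_valK.
Qed.

Lemma mdeg_mset A : mdeg (mset A) = #|A|.
Proof.
rewrite mdegE (reindex (@enum_rank G)); last exact/onW_bij/enum_rank_bij.
by rewrite -sum1_card [RHS]big_mkcond; apply: eq_bigr => v _; rewrite msetE;
  case: (v \in A).
Qed.

Lemma mset_eq0 A : (mset A == 0%MM) = (A == set0).
Proof. by rewrite -mdeg_eq0 mdeg_mset cards_eq0. Qed.

Lemma mset_coprime A B : [disjoint A & B] -> coprime_mnm (mset A) (mset B).
Proof.
move=> dAB; apply/forallP => i; rewrite !mnmE.
by have [iA|] := boolP (_ \in A); rewrite // (disjointFr dAB iA) orbT.
Qed.

Lemma mset_pairwise_coprime (As : seq {set G}) :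
  pairwise (fun A B => [disjoint A & B]) As ->
  pairwise (@coprime_mnm _) (map mset As).
Proof. by rewrite pairwise_map; apply: sub_pairwise => A B;
  apply: mset_coprime. Qed.

(** The exponents in the ideal generated by the edges of the subgraph induced on [U] and the
    variables of [W]. It stands for that subgraph without leaving the ring of [G]. *)
Definition edge_or_var U W m :=
  [exists u in U, exists v in U,
     [&& adj u v, 0 < m (enum_rank u) & 0 < m (enum_rank v)]]%N
  || [exists w in W, 0 < m (enum_rank w)]%N.

Lemma edge_or_varP U W m :
  reflect ((exists u v, [/\ u \in U, v \in U, adj u v,
                            (0 < m (enum_rank u))%N & (0 < m (enum_rank v))%N])
           \/ exists2 w, w \in W & (0 < m (enum_rank w))%N)
    (edge_or_var U W m).
Proof.
apply: (iffP orP) => -[H|H].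
- by left; case/exists_inP: H => u uU /exists_inP[v vU /and3P[]]; exists u, v.
- by right; case/exists_inP: H => w; exists w.
- left; case: H => u [v [uU vU uv mu mv]].
  by apply/exists_inP; exists u => //; apply/exists_inP; exists v; rewrite ?uv ?mu.
by right; case: H => w wW mw; apply/exists_inP; exists w.
Qed.

Lemma edge_or_var_up U W : upclosed (edge_or_var U W).
Proof.
have up m m' v : (0 < m (enum_rank v))%N -> (0 < (m + m')%MM (enum_rank v))%N.
  by move=> mv; rewrite mnmDE ltn_addr.
move=> m m' /edge_or_varP[[u [v [uU vU uv mu mv]]]|[w wW mw]]; apply/edge_or_varP.
  by left; exists u, v; rewrite !up.
by right; exists w; rewrite ?up.
Qed.

Lemma edge_ideal_mono p :
  edge_ideal p <-> mono_ideal (edge_or_var setT set0) (p : S).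
Proof.
have gI := mono_ideal_graded k (@edge_or_var_up setT set0).
split=> [[c ->]|].
  elim/big_ind: _ => [||u _]; [exact: ideal0|exact: idealD|].
  elim/big_ind: _ => [||v uv]; [exact: ideal0|exact: idealD|].
  apply: (idealMl gI); rewrite -mpolyXD; apply: mono_idealX.
  apply/edge_or_varP; left; exists u, v; rewrite !inE !mnmDE !mnm1E !eqxx.
  by rewrite addn1 add1n.
apply: mono_ideal_ind => [|m].
  split=> [|q q' [c ->] [c' ->]|q q' [c ->]|d q [c ->]].
  - exists (fun _ _ => 0); rewrite big1 // => u _.
    by rewrite big1 // => v _; rewrite mul0r.
  - exists (fun u v => c u v + c' u v); rewrite -big_split; apply: eq_bigr => u _.
    by rewrite -big_split; apply: eq_bigr => v _; rewrite mulrDl.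
  - exists (fun u v => q * c u v); rewrite mulr_sumr; apply: eq_bigr => u _.
    by rewrite mulr_sumr; apply: eq_bigr => v _; rewrite mulrA.
  exists (fun u v => hcomp (d - 2) (c u v)); rewrite raddf_sum;
    apply: eq_bigr => u _.
  rewrite raddf_sum; apply: eq_bigr => v _ /=; apply: hcompM.
  by rewrite -mpolyXD; have := @homogX k _ (U_(enum_rank u) + U_(enum_rank v));
    rewrite mdegD !mdeg1.
move=> /edge_or_varP[[u [v [_ _ uv mu mv]]]|[w]]; last by rewrite inE.
pose e := (U_(enum_rank u) + U_(enum_rank v))%MM.
have em : (e <= m)%MM.
  apply/mnm_lepP => i; rewrite mnmDE !mnm1E.
  have [<-|iu] := eqVneq (enum_rank u) i.
    by rewrite (inj_eq enum_rank_inj); have [vu|//] := eqVneq v u;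
      rewrite vu adj_irr in uv.
  by rewrite add0n; have [<-|] := eqVneq (enum_rank v) i.
(* The sum runs over both orientations of an edge; only [(u, v)] gets a coefficient. *)
exists (fun u' v' => if (u' == u) && (v' == v) then 'X_[m - e] else 0).
rewrite (bigD1 u) //= [X in _ + X]big1 ?addr0 => [|u' /negPf u'u]; last first.
  by rewrite big1 // => v' _; rewrite u'u mul0r.
rewrite (bigD1 v) //= [X in _ + X]big1 ?addr0 => [|v' /andP[_ /negPf v'v]];
  last first.
  by rewrite v'v andbF mul0r.
by rewrite !eqxx -!mpolyXD submK.
Qed.

(** Once the variable [x] is in the ideal, it absorbs all edges at [x]. *)
Lemma edge_or_var_add U W x m : x \in U ->
  edge_or_var (U :\ x) (x |: W) m =
  edge_or_var U W m || (mset [set x] <= m)%MM.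
Proof.
move=> xU; apply/idP/orP.
  case/edge_or_varP=> [[u [v [/setD1P[_ uU] /setD1P[_ vU] uv mu mv]]]|].
    by left; apply/edge_or_varP; left; exists u, v.
  case=> w /setU1P[->|wW] mw; last by left; apply/edge_or_varP; right; exists w.
  by right; apply/mset_le => v /set1P->.
case=> [/edge_or_varP[[u [v [uU vU uv mu mv]]]|[w wW mw]]|/mset_le mx].
- apply/edge_or_varP.
  have [ux|ux] := eqVneq u x; first by right; exists x; rewrite ?setU11 // -ux.
  have [vx|vx] := eqVneq v x; first by right; exists x; rewrite ?setU11 // -vx.
  by left; exists u, v; rewrite !inE ux vx.
- by apply/edge_or_varP; right; exists w => //; rewrite !inE wW orbT.
by apply/edge_or_varP; right; exists x; rewrite ?setU11 // mx ?set11.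
Qed.

(** Dividing by [x] turns the edges at [x] into the variables of its neighbours, and these absorb
    every other edge meeting [N(x)]. *)
Lemma edge_or_var_colon U W x m : x \in U -> x \notin W ->
  edge_or_var (U :\: closed_nbhd x) (W :|: (U :&: open_nbhd x)) m =
  edge_or_var U W (mset [set x] + m)%MM.
Proof.
move=> xU xW.
have posE v : (0 < (mset [set x] + m)%MM (enum_rank v))%N =
    (v == x) || (0 < m (enum_rank v))%N.
  by rewrite mnmDE msetE inE; case: eqP.
apply/idP/idP => /edge_or_varP[[u [v [uU vU uv]]]|[w]].
- move: uU vU; rewrite !in_setD => /andP[_ uU] /andP[_ vU] mu mv.
  by apply/edge_or_varP; left; exists u, v; rewrite !posE mu mv !orbT.
- move=> /setUP[wW|/setIP[wU xw]] mw; apply/edge_or_varP.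
    by right; exists w; rewrite // posE mw orbT.
  by rewrite inE in xw; left; exists x, w; rewrite !posE eqxx mw orbT.
- rewrite !posE => mu mv; apply/edge_or_varP.
  have nbr y z : adj y z -> z \in U -> y == x -> (0 < m (enum_rank z))%N ->
      exists2 w, w \in W :|: (U :&: open_nbhd x) & (0 < m (enum_rank w))%N.
    by move=> yz zU /eqP yx mz; exists z; rewrite // !inE zU -yx yz orbT.
  have vu : adj v u by rewrite adj_sym.
  have nxx y z : adj y z -> y == x -> z == x -> False.
    by move=> yz /eqP yx /eqP zx; rewrite yx zx adj_irr in yz.
  have [ux|ux] := boolP (u == x).
    by right; apply: (nbr u v) => //; case/orP: mv => // vx;
      case: (nxx u v uv ux vx).
  have [vx|vx] := boolP (v == x).
    by right; apply: (nbr v u) => //; move: mu; rewrite (negPf ux).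
  rewrite (negPf ux) (negPf vx) /= in mu mv.
  have [xu|xu] := boolP (adj x u); first by right; exists u;
    rewrite // !inE uU xu orbT.
  have [xv|xv] := boolP (adj x v); first by right; exists v;
    rewrite // !inE vU xv orbT.
  by left; exists u, v; rewrite !inE uU vU (negPf ux) (negPf vx) xu xv.
move=> wW; rewrite posE => mw; apply/edge_or_varP; right; exists w.
  by rewrite inE wW.
by case/orP: mw => // /eqP wx; rewrite wx (negPf xW) in wW.
Qed.

(** Only the variables of [W] are left, and their Koszul complex has regularity 0; the slack [r]
    lets the base case meet any bound. *)
Lemma edgeless_resolution U W (r : nat) : {in U &, forall u v, ~~ adj u v} ->
  exists F : graded_free_resolution (mono_ideal (edge_or_var U W) : S -> Prop),
    (forall i c, dg F i c <= i%:Z + r%:Z) /\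
    exists N, forall i, (N < i)%N -> res_rank F i = 0%N.
Proof.
move=> indU; pose fs := map mset (map set1 (enum W)).
have cop : pairwise (@coprime_mnm _) fs.
  apply: mset_pairwise_coprime; rewrite pairwise_map.
  have := enum_uniq (mem W); rewrite uniq_pairwise; apply: sub_pairwise => u v /=.
  by rewrite disjoints1 inE.
have fs0 : 0%MM \notin fs.
  apply/negP => /mapP[A /mapP[w _ ->]] /esym/eqP; rewrite mset_eq0 -cards_eq0.
  by rewrite cards1.
have [K [_ _ rkK degK]] := koszul_resolution k cop fs0.
have DE m : dvd_some fs m = edge_or_var U W m.
  apply/hasP/edge_or_varP => [[_ /mapP[_ /mapP[w wW ->] ->] /mset_le mw]|].
    by right; exists w; rewrite ?mw ?set11 // -mem_enum.
  case=> [[u [v [uU vU uv _ _]]]|[w wW mw]].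
    by have := indU u v uU vU; rewrite uv.
  exists (mset [set w]); last by apply/mset_le => v /set1P->.
  by rewrite /fs map_f ?map_f ?mem_enum.
have IE p : mono_ideal (dvd_some fs) p <-> mono_ideal (edge_or_var U W) (p : S).
  by split=> Ip m /Ip; rewrite DE.
exists (resolution_ext IE K); split; last by exists (size fs).
move=> i c; apply: (le_trans (degK _ i c)); last by rewrite lerDl.
by move=> _ /mapP[A /mapP[w _ ->] ->]; rewrite mdeg_mset cards1.
Qed.

(** The colon part must satisfy a bound smaller by one: its basis vectors enter the horseshoe with
    degree raised by the degree 1 of [x] but in the same homological degree. *)
Lemma edge_or_var_horseshoe U W x (r : nat) : x \in U -> x \notin W ->
    (exists F : graded_free_resolution
         (mono_ideal (edge_or_var (U :\ x) (x |: W)) : S -> Prop),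
       (forall i c, dg F i c <= i%:Z + r.+1%:Z) /\
       exists N, forall i, (N < i)%N -> res_rank F i = 0%N) ->
    (exists F : graded_free_resolution
         (mono_ideal (edge_or_var (U :\: closed_nbhd x)
            (W :|: (U :&: open_nbhd x))) : S -> Prop),
       (forall i c, dg F i c <= i%:Z + r%:Z) /\
       exists N, forall i, (N < i)%N -> res_rank F i = 0%N) ->
  exists F : graded_free_resolution (mono_ideal (edge_or_var U W) : S -> Prop),
    (forall i c, dg F i c <= i%:Z + r.+1%:Z) /\
    exists N, forall i, (N < i)%N -> res_rank F i = 0%N.
Proof.
move=> xU xW [A [degA [NA rkA]]] [B [degB [NB rkB]]].
have up := @edge_or_var_up U W; have gI := mono_ideal_graded k up.
have AE p : mono_ideal (edge_or_var (U :\ x) (x |: W)) p <->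
    ideal_add (mono_ideal (edge_or_var U W)) ('X_[mset [set x]] : S) p.
  by rewrite ideal_add_mono //; split=> Ip m /Ip; rewrite edge_or_var_add.
have BE p : mono_ideal (edge_or_var (U :\: closed_nbhd x) (W :|: (U :&:
  open_nbhd x))) p
    <-> colon (mono_ideal (edge_or_var U W)) ('X_[mset [set x]] : S) p.
  by rewrite colon_mono; split=> Ip m /Ip; rewrite edge_or_var_colon.
have hx : homog_of_degree 1 ('X_[mset [set x]] : S).
  by have := @homogX k _ (mset [set x]); rewrite mdeg_mset cards1.
have [T [rkT degT]] := horseshoe gI hx (resolution_ext AE A) (resolution_ext BE B).
exists T; split=> [i t|].
  case: (degT i t) => -[c ->]; first exact: degA.
  by rewrite -addn1 PoszD addrA lerD2r; apply: degB.
exists (maxn NA NB) => i; rewrite gtn_max => /andP[iA iB].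
by rewrite rkT /= rkA ?rkB.
Qed.

(** Vertex-decomposability descends to graphs on ever new subtypes, so [H] is tracked through an
    embedding [phi] into the fixed [G], its image playing the role of [U]. *)
Lemma vertex_decomposable_resolution (H : sgraph) (phi : H -> G) W :
    cycle_free 4 G -> cycle_free 5 G -> vertex_decomposable H ->
    injective phi -> (forall a b : H, adj (phi a) (phi b) = adj a b) ->
    [disjoint phi @: setT & W] ->
  exists F : graded_free_resolution
      (mono_ideal (edge_or_var (phi @: setT) W) : S -> Prop),
    (forall i c, dg F i c <= i%:Z + (im H)%:Z) /\
    exists N, forall i, (N < i)%N -> res_rank F i = 0%N.
Proof.
move=> C4 C5 vdH;
  elim: vdH phi W => {H} [H E0|H x shx _ IH1 _ IH2] phi W inj adjE dW.
  apply: edgeless_resolution => _ _ /imsetP[u _ ->] /imsetP[v _ ->].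
  rewrite adjE; apply/negP => uv.
  have : [set u; v] \in edges H by apply/edgesP; exists u, v.
  by rewrite E0 inE.
(* Cycle-freeness is known for [G]; in the pointwise form asked for by [shedding_dominated] it pulls
   back along [phi]. *)
have [y xy ysub] :
    exists2 y : H, adj x y & forall z : H, adj y z -> z \in closed_nbhd x.
  apply: shedding_dominated shx => [a b c d|a b c d e].
    by rewrite -!adjE -!(inj_eq inj); apply: no_induced_C4.
  by rewrite -!adjE; apply: no_induced_C5.
have im1 : (im (del [set x]) <= im H)%N by apply: im_induced.
have im2 := im_del_nbhd xy ysub.
have xU : phi x \in phi @: setT by apply: imset_f.
have xW : phi x \notin W by rewrite (disjointFr dW xU).
have img (V : {set H}) : (phi \o val) @: [set: del V] = phi @: (~: V).
  apply/setP => z; apply/imsetP/imsetP => [[u _ ->]|[u uV ->]].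
    by exists (val u) => //; apply: (valP u).
  by exists (exist _ u uV).
have injV (V : {set H}) : injective (phi \o val : del V -> G).
  by move=> u v /inj/val_inj.
have adjV (V : {set H}) (u v : del V) :
    adj ((phi \o val) u) ((phi \o val) v) = adj u v by rewrite /= adjE.
have img1 : phi @: (~: [set x]) = phi @: setT :\ phi x.
  apply/setP => z; rewrite in_setD1;
    apply/imsetP/andP => [[u]|[zx /imsetP[u _ zE]]].
    by rewrite !inE => ux ->; rewrite (inj_eq inj) ux imset_f.
  by exists u; rewrite // !inE -(inj_eq inj) -zE.
have img2 : phi @: (~: closed_nbhd x) = phi @: setT :\: closed_nbhd (phi x).
  apply/setP => z; apply/imsetP/setDP => [[u]|[/imsetP[u _ ->]]].
    rewrite !inE => ux ->; by rewrite imset_f ?(inj_eq inj) ?adjE.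
  by rewrite !inE (inj_eq inj) adjE => ux; exists u; rewrite // !inE.
have := IH1 _ (phi x |: W) (injV _) (adjV _); rewrite img img1.
have := IH2 _ (W :|: (phi @: setT :&: open_nbhd (phi x))) (injV _) (adjV _).
rewrite img img2 => {}IH2 {}IH1.
(* [im2] excludes [im H = 0]; writing [im H = r.+1] gives the bounds [r.+1] and [r] of the horseshoe
   step. *)
case: (im H) im1 im2 => // r im1 im2.
apply: (edge_or_var_horseshoe xU xW).
  case: IH1 => [|F [degF fF]].
    rewrite disjoint_sym disjoints_subset; apply/subsetP => z.
    rewrite !inE => /orP[->//|zW]; rewrite negb_and orbC.
    by rewrite (disjointFl dW zW).
  exists F; split=> // i c; apply: (le_trans (degF i c)).
  by rewrite lerD2l lez_nat.
case: IH2 => [|F [degF fF]].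
  rewrite disjoint_sym disjoints_subset; apply/subsetP => z.
  rewrite !inE => /orP[zW|/andP[_ xz]]; first by rewrite (disjointFl dW zW) andbF.
  by rewrite xz orbT.
exists F; split=> // i c; apply: (le_trans (degF i c)).
by rewrite lerD2l lez_nat -ltnS.
Qed.

Lemma edge_ideal_betti_im (F : graded_free_resolution (@edge_ideal k G)) :
  exists c, dg F (im G) c = (im G).*2%:Z.
Proof.
have [M indM cardM] := im_attained G.
have /induced_matchingP[Me Mt MH] := indM.
pose gs := map mset (map set1 (enum (~: cover M))); pose fs := map mset (enum M).
have Mcard A : A \in M -> #|A| = 2.
  move=> /(subsetP Me)/edgesP[u [v [uv ->]]]; rewrite cards2.
  by case: eqP uv => // ->; rewrite adj_irr.
have cop : pairwise (@coprime_mnm _) (gs ++ fs).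
  rewrite -map_cat; apply: mset_pairwise_coprime; rewrite pairwise_cat.
  apply/and3P; split.
  - apply/allrelP => _ A /mapP[v + ->]; rewrite !mem_enum inE => vM AM.
    by rewrite disjoints1; apply: contra vM => vA; apply/bigcupP; exists A.
  - rewrite pairwise_map; have := enum_uniq (mem (~: cover M)).
    rewrite uniq_pairwise; apply: sub_pairwise => u v /=.
    by rewrite disjoints1 inE.
  have := enum_uniq (mem M); rewrite uniq_pairwise.
  apply: (sub_in_pairwise (P := mem M)).
    by move=> A B AM BM; apply: (trivIsetP Mt).
  by apply/allP => A; rewrite mem_enum.
have n0 : 0%MM \notin gs ++ fs.
  rewrite -map_cat; apply/negP => /mapP[A As /esym/eqP];
    rewrite mset_eq0 => /eqP A0.
  move: As; rewrite A0 mem_cat => /orP[/mapP[w _ /setP/(_ w)]|];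
    first by rewrite !inE eqxx.
  by rewrite mem_enum => /Mcard; rewrite cards0.
have sub1 (p : S) : mono_ideal (dvd_some fs) p -> mono_ideal (edge_or_var setT
  set0) p.
  move=> Ip m /Ip /hasP[_ /mapP[A + ->]]; rewrite mem_enum.
  move=> /(subsetP Me)/edgesP[u [v [uv ->]]] /mset_le pos.
  by apply/edge_or_varP; left; exists u, v; rewrite !pos ?inE ?eqxx ?orbT.
have sub2 (p : S) : mono_ideal (edge_or_var setT set0) p -> mono_ideal (dvd_some
  (gs ++ fs)) p.
  move=> Ip m /Ip /edge_or_varP[[u [v [_ _ uv mu mv]]]|[w]]; last by rewrite inE.
  have out w : w \notin cover M -> (0 < m (enum_rank w))%N -> dvd_some (gs ++ fs) m.
    move=> wM mw; apply/hasP; exists (mset [set w]).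
      by rewrite mem_cat map_f // map_f // mem_enum inE.
    by apply/mset_le => z /set1P->.
  (* An edge with both ends covered belongs to [M], because [M] is induced; any other edge is
     divisible by an uncovered variable. *)
  have [uM|/out->//] := boolP (u \in cover M).
  have [vM|/out->//] := boolP (v \in cover M).
  apply/hasP; exists (mset [set u; v]).
    by rewrite mem_cat orbC map_f // mem_enum MH.
  by apply/mset_le => z /set2P[] ->.
have gI := mono_ideal_graded k (@edge_or_var_up setT set0).
have [c cE] := betti_complete_intersection (resolution_ext edge_ideal_mono F)
  gI cop n0 sub1 sub2.
have sfs : size fs = im G by rewrite size_map -cardE.
have sumfs : (\sum_(f <- fs) mdeg f)%N = (im G).*2.
  rewrite big_map big_enum /= -cardM -muln2 -sum_nat_const; apply: eq_bigr => A AM.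
  by rewrite mdeg_mset Mcard.
by rewrite sfs in c cE; exists c; rewrite -sumfs -cE.
Qed.

End EdgeIdeals.

Theorem theorem24 (k : fieldType) (G : sgraph) :
  cycle_free 4 G -> cycle_free 5 G -> vertex_decomposable G ->
  has_regularity (@edge_ideal k G) (Posz (im G)).
Proof.
move=> C4 C5 vdG.
have img : id @: [set: G] = setT by apply/setP => z; rewrite !inE; apply/imsetP;
  exists z.
have := @vertex_decomposable_resolution k G G id set0 C4 C5 vdG (@inj_id G)
  (fun _ _ => erefl).
rewrite img disjoints_subset setC0 => /(_ (subsetT _))[F0 [degF0 [N rkF0]]].
have gI := mono_ideal_graded k (@edge_or_var_up G setT set0).
split.
  have [F minF] := minimal_resolution_exists gI rkF0.
  have IE p : mono_ideal (edge_or_var setT set0) p <-> @edge_ideal k G p.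
    by rewrite edge_ideal_mono.
  by exists (resolution_ext IE F).
move=> F minF; split.
  have [c cE] := edge_ideal_betti_im F.
  exists (im G), (im G).*2%:Z; split; last by rewrite -addnn PoszD addrK.
  by apply/eqP; rewrite -lt0n; apply/card_gt0P; exists c; rewrite inE cE.
move=> i j /eqP; rewrite -lt0n => /card_gt0P[c]; rewrite inE => /eqP <-.
pose F' := resolution_ext (@edge_ideal_mono k G) F.
have minF' : minimal_resolution F' by apply: minF.
(* With the minimal [F'] at both ends and the identity between them, each basis degree of [F] is
   also one of [F0], where the bound is known. *)
have [|||b bE] := @betti_between k _ _ _ _ F' F0 F' (fun i => 1%:M) gI gI
  (fun _ => id) (fun _ => id) minF' minF' _ _ i c c.
- by rewrite mul1mx subrr => r; rewrite mxE; apply: ideal0.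
- by move=> i'; rewrite mulmx1 mul1mx.
- by rewrite mxE eqxx mcoeff1 eqxx oner_neq0.
by rewrite lerBlDl -[X in X <= _]bE; apply: degF0.
Qed.
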